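(* Let $\mathfrak g$ be a contragredient Lie algebra of finite growth with symmetrizable Cartan matrix, $\mathcal A$ a $\mathfrak g$-admissible algebra, $\alpha$ a real root of $\mathfrak g$, and $\mathfrak m=\mathfrak n^w$, $w\in W$, a maximal nilpotent subalgebra of $\mathfrak g$ such that $e_\alpha$ is a simple positive root vector of $\mathfrak m$. Then for any $x\in\mathcal A'$ and any $y\in\mathrm{Nr}(\mathcal A'\mathfrak m^{s_\alpha})$, $$q_{\alpha,\mathfrak m}(xy)=q_{\alpha,\mathfrak m}(x)\,q_{\alpha,\mathfrak m}(y).$$
   Context: The ground field is $\mathbb C$. $\mathfrak g$ is a contragredient (Kac–Moody) Lie algebra of finite growth with symmetrizable Cartan matrix $(a_{i,j})$, Gauss decomposition $\mathfrak g=\mathfrak n_-+\mathfrak h+\mathfrak n$, simple roots $\Pi=\{\alpha_i\}$, root system $\Delta=\Delta_+\sqcup\Delta_-$, real roots $\Delta^{re}$, Weyl group $W$. Chevalley generators $e_{\pm\alpha_i}$, $h_{\alpha_i}\in\mathfrak h$ satisfy $[e_{\alpha_i},e_{-\alpha_j}]=\delta_{i,j}h_{\alpha_i}$, $[h_{\alpha_i},e_{\pm\alpha_j}]=\pm a_{i,j}e_{\pm\alpha_j}$ and the Serre relations; $d_i\in\mathbb N$ are such that $(\alpha_i,\alpha_j)=d_ia_{i,j}=d_ja_{j,i}$. For a root $\gamma=\sum n_i\alpha_i$ put $t_\gamma=\sum n_id_ih_{\alpha_i}$; $h_\gamma=2t_\gamma/(\gamma,\gamma)$ (the coroot) if $\gamma$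 is real, $h_\gamma=t_\gamma$ if $\gamma$ is imaginary. For real $\gamma$, $e_{\pm\gamma}$ are root vectors of weight $\pm\gamma$ with $[e_\gamma,e_{-\gamma}]=h_\gamma$. $s_\alpha\in W$ is the reflection in a real root $\alpha$. For $w\in W$, $T_w$ is a lift of $w:\mathfrak h\to\mathfrak h$ to an automorphism of $U(\mathfrak g)$ (satisfying the braid relations), and $\mathfrak n^w=T_w(\mathfrak n)$, the subalgebra with root set $w(\Delta_+)$; for $\mathfrak m=\mathfrak n^w$, ''$e_\alpha$ is a simple positive root vector of $\mathfrak m$'' means $\alpha\in w(\Pi)$, and $\mathfrak m^{s_\alpha}=T_{s_\alpha}(\mathfrak m)$ is the subalgebra with root set $s_\alpha w(\Delta_+)$. $D$ is the localization of $U(\mathfrak h)$ at the multiplicative set generated by $\{h_\gamma+k:\gamma\in\Delta,k\in\mathbb Z\}$. For an integral weight $\mu$, $\tau_\mu$ is the automorphism of $D$ with $\tau_\mu(h)=h+\langle h,\mu\rangle$, $h\in\mathfrak h$. An associative algebra $\mathcal A$ containing $U(\mathfrak g)$ as a subalgebra carries the adjoint action of $U(\mathfrak g)$, denoted $\hat g(a)=\mathrm{ad}_g(a)$, with $\hat g(a)=ga-ag$ for $g\in\mathfrak g$. $\mathcal A$ is called $\mathfrak g$-admissible if: (a) there is a subspace $\mathcal V\subset\mathcal A$, invariant under the adjoint action, such that multiplication induces isomorphisms of vector spaces $U(\mathfrak g)\otimes\mathcal V\to\mathcal A$ and $\mathcal V\otimes U(\mathfrak g)\to\mathcal A$; (b)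 the adjoint action on $\mathcal V$ of every real root vector is locally nilpotent, and the adjoint action of $\mathfrak h$ on $\mathcal V$ is semisimple. Put $\mathcal A'=D\otimes_{U(\mathfrak h)}\mathcal A$ (the localized algebra). For a nilpotent subalgebra $\mathfrak m$, $\mathcal A'\mathfrak m$ is the left ideal generated by $\mathfrak m$, $\mathrm{Nr}(\mathcal A'\mathfrak m)=\{x\in\mathcal A':\mathfrak m x\subset\mathcal A'\mathfrak m\}$, and $Z^{\mathfrak m}(\mathcal A)=\mathrm{Nr}(\mathcal A'\mathfrak m)/\mathcal A'\mathfrak m$. The algebra $Z^{\mathfrak m}(\mathcal A)$ acts on $\mathcal A'/\mathcal A'\mathfrak m$ on the right by multiplication. The map $q_{\alpha,\mathfrak m}:\mathcal A'\to\mathcal A'/\mathcal A'\mathfrak m$ is defined by $$q_{\alpha,\mathfrak m}(x)=\sum_{n\ge0}\frac{(-1)^n}{n!}\,\hat e_\alpha^{\,n}(x)\,e_{-\alpha}^n\,\big(h_\alpha(h_\alpha-1)\cdots(h_\alpha-n+1)\big)^{-1}\mod\mathcal A'\mathfrak m,\qquad x\in\mathcal A,$$ and extended to $\mathcal A'$ by $q_{\alpha,\mathfrak m}(xd)=q_{\alpha,\mathfrak m}(x)\tau_\alpha(d)$, $d\in D$. It sends $\mathrm{Nr}(\mathcal A'\mathfrak m^{s_\alpha})$ into $Z^{\mathfrak m}(\mathcal A)$; the product $q_{\alpha,\mathfrak m}(x)q_{\alpha,\mathfrak m}(y)$ is the right action of $q_{\alpha,\mathfrak m}(y)\in Z^{\mathfrak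 m}(\mathcal A)$ on $q_{\alpha,\mathfrak m}(x)\in\mathcal A'/\mathcal A'\mathfrak m$. *)

(* Defs.v *)
From HB Require Import structures.
From mathcomp Require Import all_boot all_order all_algebra.
From mathcomp Require Import complex.
From mathcomp Require Import boolp classical_sets functions cardinality fsbigop reals.

Set Implicit Arguments.
Unset Strict Implicit.
Unset Printing Implicit Defensive.

Import GRing.Theory.
Local Open Scope classical_set_scope.
Local Open Scope ring_scope.

(** The element described by [P] if there is one, and [x0] otherwise; it is only
    applied to predicates satisfied by exactly one element. *)
Definition description (T : Type) (x0 : T) (P : set T) : T :=
  if pselect (exists x, P x) is left exP then projT1 (cid exP) else x0.

Record lieAlgebra (F : fieldType) := LieAlgebra {
  lie_sort :> lmodType F;
  bracket : lie_sort -> lie_sort -> lie_sort;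
  bracketDl : forall a x y z,
    bracket (a *: x + y) z = a *: bracket x z + bracket y z;
  bracketDr : forall a x y z,
    bracket z (a *: x + y) = a *: bracket z x + bracket z y;
  bracketxx : forall x, bracket x x = 0;
  jacobi : forall x y z,
    bracket x (bracket y z) + bracket y (bracket z x)
      + bracket z (bracket x y) = 0 }.

Lemma abelian_bracketDl (F : fieldType) (V : lmodType F) (a : F) (x y z : V) :
  0 = a *: (0 : V) + 0.
Proof. by rewrite scaler0 addr0. Qed.

Lemma abelian_jacobi (F : fieldType) (V : lmodType F) (x y z : V) :
  0 + 0 + 0 = 0 :> V.
Proof. by rewrite !addr0. Qed.

Definition abelian_lie (F : fieldType) (V : lmodType F) : lieAlgebra F :=
  LieAlgebra (bracket := fun _ _ : V => 0)
    (@abelian_bracketDl F V) (@abelian_bracketDl F V)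
    (fun=> erefl) (@abelian_jacobi F V).

Definition is_subalgebra (F : fieldType) (L : lieAlgebra F) (S : set L) : Prop :=
  [/\ S 0, forall a x y, S x -> S y -> S (a *: x + y)
    & forall x y, S x -> S y -> S (bracket x y)].

Definition is_ideal (F : fieldType) (L : lieAlgebra F) (S : set L) : Prop :=
  [/\ S 0, forall a x y, S x -> S y -> S (a *: x + y)
    & forall x y, S y -> S (bracket x y)].

Definition is_lie_hom (F : fieldType) (L : lieAlgebra F) (B : algType F)
    (f : L -> B) : Prop :=
  forall x y, f (bracket x y) = f x * f y - f y * f x.

(** [i : L -> U] exhibits [U] as the universal enveloping algebra of [L] *)
Definition is_uea (F : fieldType) (L : lieAlgebra F) (U : algType F)
    (i : {linear L -> U}) : Prop :=
  is_lie_hom i /\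
  forall (B : algType F) (f : {linear L -> B}), is_lie_hom f ->
    exists g : {lrmorphism U -> B},
      (forall x, g (i x) = f x) /\
      (forall g' : {lrmorphism U -> B}, (forall x, g' (i x) = f x) -> g' =1 g).

(** A contragredient Lie algebra with Cartan matrix symmetrized by [symm].  The
    pair [(km_coroot, km_root)] is a minimal realization of the Cartan matrix.  The Serre relations are implied by [km_no_ideal] (Gabber-Kac), but
    are kept among the defining relations. *)
Record kacMoody (F : fieldType) := KacMoody {
  km_lie :> lieAlgebra F;
  km_size : nat;
  cartan : 'M[int]_km_size;
  cartan_diag : forall i, cartan i i = 2;
  cartan_le0 : forall i j, i != j -> cartan i j <= 0;
  cartan_eq0 : forall i j, cartan i j = 0 -> cartan j i = 0;
  symm : 'I_km_size -> nat;
  symm_gt0 : forall i, (0 < symm i)%N;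
  symmP : forall i j, (symm i)%:Z * cartan i j = (symm j)%:Z * cartan j i;
  cartan_alg : vectType F;
  incl : {linear cartan_alg -> km_lie};
  incl_inj : injective incl;
  km_coroot : km_size.-tuple cartan_alg;
  km_root : km_size.-tuple 'Hom(cartan_alg, F^o);
  km_coroot_free : free km_coroot;
  km_root_free : free km_root;
  km_pairing : forall i j,
    tnth km_root j (tnth km_coroot i) = (cartan i j)%:~R;
  km_minimal : (\dim {: cartan_alg}
    + \rank (map_mx intr cartan : 'M[F]_km_size) = km_size.*2)%N;
  km_e : 'I_km_size -> km_lie;
  km_f : 'I_km_size -> km_lie;
  km_hh : forall h h', bracket (incl h) (incl h') = 0;
  km_he : forall h i, bracket (incl h) (km_e i) = (tnth km_root i h : F) *: km_e i;
  km_hf : forall h i, bracket (incl h) (km_f i) = - (tnth km_root i h : F) *: km_f i;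
  km_ef : forall i j, bracket (km_e i) (km_f j) =
    if i == j then incl (tnth km_coroot i) else 0;
  km_serre_e : forall i j, i != j ->
    iter `|1 - cartan i j|%N (bracket (km_e i)) (km_e j) = 0;
  km_serre_f : forall i j, i != j ->
    iter `|1 - cartan i j|%N (bracket (km_f i)) (km_f j) = 0;
  km_generated : forall S : set km_lie, is_subalgebra S ->
    (forall h, S (incl h)) -> (forall i, S (km_e i)) -> (forall i, S (km_f i)) ->
    forall x, S x;
  km_no_ideal : forall S : set km_lie, is_ideal S ->
    (forall h, S (incl h) -> h = 0) -> forall x, S x -> x = 0 }.

Arguments cartan {F g} : rename.
Arguments symm {F g} i : rename.
Arguments incl {F g} : rename.

Section Roots.
Variables (F : fieldType) (g : kacMoody F).

Definition weight := 'Hom(cartan_alg g, F^o).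
Implicit Types (lam gam : weight).

Definition root_space gam : set g :=
  [set x | forall h, bracket (incl h) x = (gam h : F) *: x].

Definition roots : set weight :=
  [set gam | gam != 0 /\ exists2 x, root_space gam x & x != 0].

Definition pos_roots : set weight :=
  [set gam | roots gam /\ exists n : 'I_(km_size g) -> nat,
               gam = \sum_i (n i)%:R *: tnth (km_root g) i].

Definition simple_refl (i : 'I_(km_size g)) lam : weight :=
  lam - (lam (tnth (km_coroot g) i) : F) *: tnth (km_root g) i.

Inductive in_weyl : (weight -> weight) -> Prop :=
| weyl_id : in_weyl id
| weyl_step i w : in_weyl w -> in_weyl (simple_refl i \o w).

Definition real_roots : set weight :=
  [set gam | exists i w, in_weyl w /\ gam = w (tnth (km_root g) i)].

Definition root_coord (i : 'I_(km_size g)) gam : F := coord (km_root g) i gam.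

Definition root_norm gam : F :=
  \sum_i \sum_j
    root_coord i gam * root_coord j gam * ((symm i)%:R * (cartan i j)%:~R).

Definition t_ gam : cartan_alg g :=
  \sum_i (root_coord i gam * (symm i)%:R) *: tnth (km_coroot g) i.

(** The coroot for a real root, [t_ gam] for an imaginary root *)
Definition h_ gam : cartan_alg g :=
  if `[< real_roots gam >] then (2 / root_norm gam) *: t_ gam else t_ gam.

Definition refl gam lam : weight := lam - (lam (h_ gam) : F) *: gam.

Definition root_span (P : set weight) : set g :=
  [set x | exists s : seq g,
     (forall y, y \in s -> exists2 gam, P gam & root_space gam y) /\
     x = \sum_(y <- s) y].

(** The subalgebra n^w = T_w(n): it has root set w(Delta_+) *)
Definition nil_subalg (w : weight -> weight) : set g :=
  root_span (w @` pos_roots).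

(** Components of the principal grading, deg e_i = 1 and deg f_i = -1 *)
Definition principal_comp (z : int) : set g :=
  root_span [set gam | exists n : 'I_(km_size g) -> int,
     gam = \sum_i (n i)%:~R *: tnth (km_root g) i /\ \sum_i n i = z].

Definition dim_le (S : set g) (N : nat) : Prop :=
  exists b : 'I_N -> g, forall x, S x -> exists c : 'I_N -> F,
    x = \sum_i c i *: b i.

Definition finite_growth : Prop :=
  exists c k : nat, forall z : int,
    dim_le (principal_comp z) (c * `|z|.+1 ^ k)%N.

End Roots.

Section Tensor.
Variables (S : Type) (M N : zmodType).
Variables (actr : M -> S -> M) (actl : S -> N -> N).

Definition balanced (W : zmodType) (b : M -> N -> W) : Prop :=
  [/\ forall x x' y, b (x + x') y = b x y + b x' y,
      forall x y y', b x (y + y') = b x y + b x y'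
    & forall x s y, b (actr x s) y = b x (actl s y)].

(** [m : M -> N -> P] induces an isomorphism from the tensor product of [M] and
    [N] over [S] to [P] *)
Definition is_tensor (P : zmodType) (m : M -> N -> P) : Prop :=
  balanced m /\
  forall (W : zmodType) (b : M -> N -> W), balanced b ->
    exists f : {additive P -> W},
      (forall x y, f (m x y) = b x y) /\
      (forall f' : {additive P -> W}, (forall x y, f' (m x y) = b x y) -> f' =1 f).

End Tensor.

Definition mult_closure (B : comPzRingType) (X : set B) : set B :=
  [set u | exists s : seq B, (forall x, x \in s -> X x) /\ u = \prod_(x <- s) x].

Definition is_localization (F : fieldType) (B : comAlgType F)
    (D : comUnitAlgType F) (phi : {lrmorphism B -> D}) (S : set B) : Prop :=
  [/\ forall s, S s -> phi s \is a GRing.unit,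
      forall d, exists u s, S s /\ d = phi u / phi s
    & forall u, phi u = 0 -> exists2 s, S s & s * u = 0].

Definition ad_op (B : pzRingType) (b a : B) : B := b * a - a * b.

Section Admissible.
Variables (F : fieldType) (g : kacMoody F) (U : algType F)
  (iU : {linear g -> U}) (A : algType F) (jA : {lrmorphism U -> A}).

(** [nu] is the embedding of the subspace V into A *)
Definition admissible : Prop :=
  injective jA /\
  exists (V : lmodType F) (nu : {linear V -> A}), injective nu /\
    [/\ (forall (x : g) v, exists v', ad_op (jA (iU x)) (nu v) = nu v'),
        is_tensor (fun (u : U) (c : F) => c *: u) (fun (c : F) (v : V) => c *: v)
          (fun u v => jA u * nu v),
        is_tensor (fun (v : V) (c : F) => c *: v) (fun (c : F) (u : U) => c *: u)
          (fun v u => nu v * jA u),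
        (forall gam x, real_roots gam -> root_space gam x ->
           forall v, exists n, iter n (ad_op (jA (iU x))) (nu v) = 0)
      & (forall v, exists s : seq V, v = \sum_(u <- s) u /\
           forall u, u \in s -> exists mu : weight g, forall h,
             ad_op (jA (iU (incl h))) (nu u) = (mu h : F) *: nu u)].

End Admissible.

Section LeftIdeal.
Variable B : pzRingType.

Definition left_ideal (X : set B) : {pred B} :=
  fun x => `[< exists s : seq (B * B), (forall p, p \in s -> X p.2) /\
                 x = \sum_(p <- s) p.1 * p.2 >].

Lemma left_ideal_zmod (X : set B) : zmod_closed (left_ideal X).
Proof.
split.
  by apply/asboolP; exists [::]; split=> //; rewrite big_nil.
move=> x y /asboolP [s [Xs ->]] /asboolP [t [Xt ->]]; apply/asboolP.
exists (s ++ [seq (- p.1, p.2) | p <- t]); split.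
  by move=> p; rewrite mem_cat => /orP [/Xs //|/mapP [q /Xt Xq ->]].
rewrite big_cat big_map /= -sumrN; congr (_ + _).
by apply: eq_bigr => p _; rewrite mulNr.
Qed.

HB.instance Definition _ (X : set B) :=
  GRing.isZmodClosed.Build B (left_ideal X) (left_ideal_zmod X).

Definition lquot (X : set B) : zmodType := {ideal_quot (left_ideal X)}.

Definition lclass (X : set B) (x : B) : lquot X :=
  (\pi_({ideal_quot (left_ideal X)}) x)%qT.

Definition lrepr (X : set B) (p : lquot X) : B :=
  repr (p : {ideal_quot (left_ideal X)}).

(** Nr(BX), where BX is [left_ideal X] *)
Definition normalizer (X : set B) : set B :=
  [set x | forall e, X e -> e * x \in left_ideal X].

(** Right multiplication of a class by [b], computed on representatives; it does
    not depend on the representative whenever BX is stable under right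
    multiplication by [b], e.g. for [b] in Nr(BX). *)
Definition lquot_mulr (X : set B) (p : lquot X) (b : B) : lquot X :=
  lclass X (lrepr p * b).

(** Right action of Nr(BX)/BX on B/BX; it is only meaningful when the second
    argument is a class of elements of Nr(BX). *)
Definition lquot_act (X : set B) (p z : lquot X) : lquot X :=
  lquot_mulr p (lrepr z).

End LeftIdeal.

(** [Uh] is U(h), [kappa] its inclusion in U(g), [D] its localization at
    [denominators].  [A'] is an algebra containing the images of D and A, whose
    multiplication identifies it with the tensor product of D and A over U(h); for
    admissible A this determines the product of [A']. *)
Section Localized.
Variables (F : fieldType) (g : kacMoody F).
Variables (U : algType F) (iU : {linear g -> U}).
Variables (Uh : comAlgType F) (iUh : {linear cartan_alg g -> Uh}).
Variable kappa : {lrmorphism Uh -> U}.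
Variables (D : comUnitAlgType F) (phi : {lrmorphism Uh -> D}).
Variables (A : algType F) (jA : {lrmorphism U -> A}).
Variables (A' : algType F) (iA : {lrmorphism A -> A'}) (iD : {lrmorphism D -> A'}).

Definition denominators : set Uh :=
  mult_closure [set u | exists gam (k : int),
    roots gam /\ u = iUh (h_ gam) + k%:~R].

Definition is_localized_algebra : Prop :=
  (forall u, iA (jA (kappa u)) = iD (phi u)) /\
  is_tensor (fun d u => d * phi u) (fun u a => jA (kappa u) * a)
    (fun d a => iD d * iA a).

Definition in_A' (x : g) : A' := iA (jA (iU x)).

(** The automorphism tau_mu of D *)
Definition shift (mu : weight g) : {lrmorphism D -> D} :=
  description (idfun : {lrmorphism D -> D})
    [set t | forall h, t (phi (iUh h)) = phi (iUh h) + (mu h : F)%:A].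

(** [X] is the image of m in A'; [e] and [f] are root vectors of weights [alpha]
    and [- alpha]. *)
Variables (X : set A') (alpha : weight g) (e f : g).

(** The sum over all n, of finite support since ad e is locally nilpotent *)
Definition q_series (a : A) : A' :=
  \sum_(n \in [set: nat])
    ((-1) ^+ n / n`!%:R : F) *:
      (iA (iter n (ad_op (jA (iU e))) a) * in_A' f ^+ n *
       iD (\prod_(k < n) (phi (iUh (h_ alpha)) - k%:R))^-1).

Definition is_q (q : A' -> lquot X) : Prop :=
  [/\ forall x y, q (x + y) = q x + q y,
      forall a, q (iA a) = lclass X (q_series a)
    & forall x d, q (x * iD d) = lquot_mulr (q x) (iD (shift alpha d))].

Definition q_map : A' -> lquot X := description (fun=> 0) is_q.

End Localized.

(* Main.v *)
Require Import Defs.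
From HB Require Import structures.
From mathcomp Require Import all_boot all_order all_algebra.
From mathcomp Require Import complex.
From mathcomp Require Import boolp classical_sets fsbigop reals.
From mathcomp Require Import ring zify.

Set Implicit Arguments.
Unset Strict Implicit.
Unset Printing Implicit Defensive.

Import Order.TTheory GRing.Theory Num.Theory.
Local Open Scope classical_set_scope.
Local Open Scope ring_scope.

(** The identity is proved with representatives, by congruences modulo the left ideal
    J = A' m.  Write E, F for the images of e_alpha and e_(-alpha), H for the coroot of
    alpha, ad e for the adjoint action, c_n = (-1)^n / n!, and
      Phi_N = F^N (H (H - 1) ... (H - N + 1))^(-1),
      S_k(a) = sum_n c_n (ad e)^n(a) Phi_(k + n),
    so that q(a) is the class of S_0(a) ([divsign], [sl2_frac], [sl2_sum]).

    The Leibniz rule gives S_k(a b) = sum_j c_j (ad e)^j(a) S_(k + j)(b)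
    ([sl2_sum_mul]).  Hence q(a y) = q(a) q(y) as soon as S_j(y) = Phi_j q(y) for all j.
    Now the relations of sl2 and F Phi_N = (H + N + 2) Phi_(N + 1) ([sl2_fracS]) give
      F S_k(a) = S_k([F, a]) + (H + k + 2) S_(k + 1)(a)     ([sl2_sum_mulf]),
    and S_k(a F) is zero modulo J.  So S_(k + 1) is determined by S_k through
      (H + k + 2) S_(k + 1)(x) = F S_k(x) - S_k(F x).
    Starting from q, this recursion extends all the S_k to additive maps on A' modulo J
    ([qbar]).  They kill A' m^(s_alpha) ([qbar_left_ideal]): m^(s_alpha) is spanned by
    e_(-alpha) and by a set, the radical, that also lies in m and is stable under ad e
    and ad f.  If y normalizes A' m^(s_alpha), then F y lies in A' m^(s_alpha), the last
    term of the recursion vanishes, and S_j(y) = Phi_j q(y) follows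
    ([qbar_normalizer]).

    The right multiplication by q(y) must be well defined, that is, J q(y) must lie in J
    ([lideal_mul_q_repr]).  For E this is a telescoping sum ([sl2_sum_mule]).  For an
    element z of the radical, the Leibniz formula applied to S_k(z y), which is zero,
    expresses z S_k(y) by the products ((ad e)^j z) S_(k + j)(y) with j > 0, and an
    induction on the nilpotency order of z concludes ([radical_mul_qbar]).  Finally
    x = a d with d in D is treated by moving d to the other side of y, which replaces y
    by d y ([q_repr_iDl]).

    The root system enters through the following facts.  The sets m and m^(s_alpha) are
    spanned by the radical together with e, respectively f ([nil_subalgP],
    [nil_subalg_reflP]); this needs the triangular decomposition, the invariance of the
    roots under simple reflections ([refl_root]) and the fact that real root spaces are
    lines ([one_dim_weyl]), the last two being consequences of the theory of
    integrable sl2-modules ([sl2_F_inj]).  The series is finite because real root vectors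
    are ad-nilpotent on A ([admissible_nilpotent]).  The weights of A and the values
    on coroots of the roots are integers ([admissible_weights], [roots_h_integral]), so
    that translations by weights of A preserve the denominators ([shiftP]) and A' is
    also spanned by the products a d ([localized_span]). *)

(** * Left ideals and their quotients *)

Section LeftIdealTheory.
Variables (K : fieldType) (B : algType K) (X : set B).
Local Notation J := (left_ideal X).

Lemma left_ideal_gen u : X u -> u \in J.
Proof.
move=> Xu; apply/asboolP; exists [:: (1, u)]; split.
  by move=> p; rewrite inE => /eqP ->.
by rewrite big_seq1 mul1r.
Qed.

Lemma left_ideal_mull b x : x \in J -> b * x \in J.
Proof.
move=> /asboolP [s [Xs ->]]; apply/asboolP.
exists [seq (b * p.1, p.2) | p <- s]; split.
  by move=> p /mapP [q /Xs Xq ->].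
by rewrite big_map mulr_sumr; apply: eq_bigr => p _; rewrite mulrA.
Qed.

Lemma left_idealZ (c : K) x : x \in J -> c *: x \in J.
Proof. by move=> Jx; rewrite -mulr_algl left_ideal_mull. Qed.

Lemma left_ideal_mulr b x :
  (forall u, X u -> u * b \in J) -> x \in J -> x * b \in J.
Proof.
move=> Xb /asboolP [s [Xs ->]]; rewrite mulr_suml big_seq rpred_sum // => p ps.
by rewrite -mulrA left_ideal_mull //; apply/Xb/Xs.
Qed.

Lemma lclass_eq x y : (lclass X x = lclass X y) <-> (x - y \in J).
Proof.
rewrite Quotient.idealrBE; split => [xy|/eqP xy]; last exact: xy.
by apply/eqP; exact: xy.
Qed.

Lemma lclassD x y : lclass X (x + y) = lclass X x + lclass X y.
Proof. by rewrite /lclass !piE. Qed.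

Lemma lreprK : cancel (@lrepr B X) (lclass X).
Proof. by move=> x; rewrite /lrepr /lclass reprK. Qed.

(** The next lemmas express that [x - y \in J] is a congruence of left modules, on
    which all computations modulo a left ideal are based. *)
Lemma lideal_congr x y : x - y \in J -> y \in J -> x \in J.
Proof. by move=> xy yJ; rewrite -(subrK y x) rpredD. Qed.

Lemma lideal_refl x : x - x \in J.
Proof. by rewrite subrr rpred0. Qed.

Lemma lideal_sym x y : x - y \in J -> y - x \in J.
Proof. by move=> xy; rewrite -opprB rpredN. Qed.

Lemma lideal_trans y x z : x - y \in J -> y - z \in J -> x - z \in J.
Proof. by move=> xy yz; rewrite -(subrK y x) -addrA rpredD. Qed.

Lemma lideal_add x y x' y' : x - y \in J -> x' - y' \in J -> (x + x') - (y + y') \in J.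
Proof. by move=> xy xy'; rewrite opprD addrACA rpredD. Qed.

Lemma lideal_sub x y x' y' : x - y \in J -> x' - y' \in J -> (x - x') - (y - y') \in J.
Proof. by move=> xy xy'; apply: lideal_add => //; rewrite -opprD rpredN. Qed.

Lemma lideal_mull b x y : x - y \in J -> b * x - b * y \in J.
Proof. by move=> xy; rewrite -mulrBr left_ideal_mull. Qed.

End LeftIdealTheory.

Arguments lideal_refl {K B X} x.

(** * Tensor products, enveloping algebras and localizations *)

Section TensorSpan.
Variables (S : Type) (M N : zmodType) (actr : M -> S -> M) (actl : S -> N -> N).
Variables (P : zmodType) (m : M -> N -> P).

Definition tensor_span : {pred P} :=
  fun x => `[< exists s : seq (M * N), x = \sum_(p <- s) m p.1 p.2 >].

Hypothesis mT : is_tensor actr actl m.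

Lemma tensor_mN x y : m (- x) y = - m x y.
Proof.
have [[mD _ _] _] := mT; apply: (addrI (m x y)).
rewrite -mD !subrr; apply: (addrI (m 0 y)); by rewrite -mD !addr0.
Qed.

Lemma tensor_span_zmod : zmod_closed tensor_span.
Proof.
split; first by apply/asboolP; exists [::]; rewrite big_nil.
move=> x y /asboolP [s ->] /asboolP [t ->]; apply/asboolP.
exists (s ++ [seq (- p.1, p.2) | p <- t]).
rewrite big_cat big_map /= -sumrN; congr (_ + _).
by apply: eq_bigr => p _; rewrite tensor_mN.
Qed.

(** Only the uniqueness in the universal property is used: the projection to the
    quotient by the span of the pure tensors agrees with 0 on them, hence is 0. *)
Lemma tensor_spanP x : exists s : seq (M * N), x = \sum_(p <- s) m p.1 p.2.
Proof.
pose pm := GRing.isZmodClosed.Build P tensor_span tensor_span_zmod.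
pose I : zmodClosed P := HB.pack tensor_span pm.
pose W : zmodType := Quotient.quot I.
have [[mD1 mD2 mb] univ] := mT.
have b0 : balanced actr actl (fun _ _ => 0 : W) by split=> *; rewrite ?addr0.
have [f0 [_ f0U]] := univ W _ b0.
pose p : P -> W := fun x => (\pi_W x)%qT.
have pB : zmod_morphism p by move=> y z; rewrite /p !piE.
pose pa : {additive P -> W} := HB.pack p (GRing.isZmodMorphism.Build P W p pB).
have pm0 y z : pa (m y z) = 0.
  rewrite /= /p -[0]/(0 : W) -(raddf0 pa) /= /p; apply/eqP; rewrite -Quotient.idealrBE subr0.
  by apply/asboolP; exists [:: (y, z)]; rewrite big_seq1.
have z0 y z : (\0 : {additive P -> W}) (m y z) = 0 by [].
have : pa x = 0 by rewrite (f0U pa pm0) -(f0U _ z0).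
rewrite -(raddf0 pa) /= /p => /eqP; rewrite -Quotient.idealrBE subr0.
by move/asboolP.
Qed.
End TensorSpan.

(** Subalgebras are bundled so that the subtype that they define is an algebra, as is
    needed to apply the universal property of an enveloping algebra to it. *)
Record subalg (K : fieldType) (A : algType K) := Subalg {
  subalg_pred :> {pred A};
  subalg_predP : subalg_closed subalg_pred }.

HB.instance Definition _ (K : fieldType) (A : algType K) (S : subalg A) :=
  GRing.isSubalgClosed.Build K A (subalg_pred S) (subalg_predP S).

Definition subalg_sort (K : fieldType) (A : algType K) (S : subalg A) :=
  {x : A | x \in subalg_pred S}.

HB.instance Definition _ (K : fieldType) (A : algType K) (S : subalg A) :=
  SubChoice.on (subalg_sort S).
HB.instance Definition _ (K : fieldType) (A : algType K) (S : subalg A) :=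
  [SubChoice_isSubAlgebra of subalg_sort S by <:].

Section UEA.
Variables (K : fieldType) (L : lieAlgebra K) (U : algType K) (i : {linear L -> U}).
Hypothesis hU : is_uea i.

(** The universal property gives a map from the enveloping algebra to the subalgebra;
    followed by the inclusion, it is the identity by uniqueness. *)
Lemma uea_ind (P : set U) : P 1 -> (forall a x y, P x -> P y -> P (a *: x + y)) ->
  (forall x y, P x -> P y -> P (x * y)) -> (forall x, P (i x)) -> forall u, P u.
Proof.
move=> P1 Plin Pmul Pi u.
pose p : {pred U} := fun x => `[< P x >].
have pP : subalg_closed p.
  split; first exact/asboolP.
    by move=> a x y /asboolP Px /asboolP Py; apply/asboolP/Plin.
  by move=> x y /asboolP Px /asboolP Py; apply/asboolP/Pmul.
pose S : subalg U := Subalg pP.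
pose T : algType K := subalg_sort S.
have iS x : i x \in S by apply/asboolP.
pose f x : T := exist _ (i x) (iS x).
have flin : linear f by move=> a x y; apply: val_inj; rewrite /= linearP.
pose fl : {linear L -> T} := HB.pack f (GRing.isLinear.Build K L T *:%R f flin).
have [ilie univ] := hU.
have flie : is_lie_hom fl by move=> x y; apply: val_inj; rewrite /= ilie.
have [h [hi _]] := univ T fl flie.
have [h0 [_ h0U]] := univ U i ilie.
have vlin : linear (fun t : T => proj1_sig t) by move=> a x y.
have vmon : monoid_morphism (fun t : T => proj1_sig t) by split.
pose v : {lrmorphism T -> U} := HB.pack (fun t : T => proj1_sig t)
  (GRing.isLinear.Build K T U *:%R _ vlin) (GRing.isMonoidMorphism.Build T U _ vmon).
have e1 x : (v \o h) (i x) = i x by rewrite /= hi.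
have e2 x : (idfun : {lrmorphism U -> U}) (i x) = i x by [].
have -> : u = v (h u).
  exact: esym (etrans (h0U (v \o h : {lrmorphism U -> U}) e1 u) (esym (h0U _ e2 u))).
by case: (h u) => x /= /asboolP.
Qed.
End UEA.

Section Localization.
Variables (K : fieldType) (V : lmodType K).
Variables (Uh : comAlgType K) (iUh : {linear V -> Uh}).
Hypothesis hUh : is_uea (iUh : {linear abelian_lie V -> Uh}).
Variables (D : comUnitAlgType K) (phi : {lrmorphism Uh -> D}) (S : set Uh).
Hypothesis hD : is_localization phi S.

Lemma localization_unit s : S s -> phi s \is a GRing.unit.
Proof. by have [+ _ _] := hD; apply. Qed.

Lemma localization_frac d : exists u s, S s /\ d * phi s = phi u.
Proof.
have [_ /(_ d) [u [s [Ss ->]]] _] := hD; exists u, s; split=> //.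
by rewrite divrK // localization_unit.
Qed.

(** The set of [d] for which the identity holds is stable under products and inverses,
    so that generators suffice.  With [x] a weight vector this moves scalars of the
    localization across [x]; with [x = 1] it proves that two morphisms are equal. *)
Lemma intertwine (B : algType K) (f1 f2 : {lrmorphism D -> B}) (x : B) :
  (forall h, x * f1 (phi (iUh h)) = f2 (phi (iUh h)) * x) ->
  forall d, x * f1 d = f2 d * x.
Proof.
move=> xh; have xu : forall u, x * f1 (phi u) = f2 (phi u) * x.
  apply: (uea_ind hUh) => //.
  - by rewrite !rmorph1 mulr1 mul1r.
  - move=> a u v xu xv; rewrite !linearP /= mulrDr mulrDl -scalerAl -scalerAr.
    by rewrite xu xv.
  - by move=> u v xu xv; rewrite !rmorphM /= mulrA xu -mulrA xv mulrA.
move=> d; have [u [s [Ss du]]] := localization_frac d.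
have us := localization_unit Ss.
have f1s : f1 (phi s) * f1 (phi s)^-1 = 1 by rewrite -rmorphM mulrV ?rmorph1.
rewrite -[LHS]mulr1 -[RHS]mulr1 -f1s !mulrA; congr (_ * _).
rewrite -[LHS]mulrA -rmorphM du xu -[RHS]mulrA xu [RHS]mulrA -rmorphM.
by rewrite du.
Qed.

(** The universal property of the localization. *)
Lemma localization_ext (psi : {lrmorphism Uh -> D}) :
  S 1 -> (forall s s', S s -> S s' -> S (s * s')) ->
  (forall s, S s -> psi s \is a GRing.unit) ->
  exists t : {lrmorphism D -> D}, forall u, t (phi u) = psi u.
Proof.
move=> S1 SM Spsi.
have ex d : exists z, exists u s, [/\ S s, d * phi s = phi u & z * psi s = psi u].
  have [u [s [Ss du]]] := localization_frac d.
  by exists (psi u / psi s), u, s; split=> //; rewrite divrK // Spsi.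
pose t d := projT1 (cid (ex d)).
have tP d u s : S s -> d * phi s = phi u -> t d * psi s = psi u.
  rewrite /t; case: cid => z /= [u' [s' [Ss' du' zu']]] Ss du.
  have : phi (u' * s - u * s') = 0.
    by rewrite rmorphB !rmorphM /= -du -du' -!mulrA [phi s' * _]mulrC subrr.
  have [_ _ /[apply] [[s'' Ss'' /(congr1 psi)]]] := hD.
  rewrite rmorphM rmorphB !rmorphM /= rmorph0 => e.
  have {}e : psi u' * psi s = psi u * psi s'.
    by apply/eqP; rewrite -subr_eq0 -(mulrI_eq0 _ (mulrI (Spsi _ Ss''))) e.
  by apply: (mulIr (Spsi _ Ss')); rewrite -e -zu' mulrAC.
have tphi u : t (phi u) = psi u.
  by have := tP (phi u) u 1 S1; rewrite !rmorph1 !mulr1; apply.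
have tlin : linear t.
  move=> a x y; have [u [s [Ss xu]]] := localization_frac x.
  have [v [s' [Ss' yv]]] := localization_frac y.
  apply: (mulIr (Spsi _ (SM _ _ Ss Ss'))).
  rewrite (tP _ (a *: (u * s') + v * s) _ (SM _ _ Ss Ss')); last first.
    rewrite linearP !rmorphM /= mulrDl -scalerAl -xu -yv !mulrA.
    by congr (_ + _); rewrite mulrAC.
  rewrite linearP !rmorphM /= mulrDl -scalerAl.
  by rewrite -(tP _ _ _ Ss xu) -(tP _ _ _ Ss' yv) !mulrA; congr (_ + _); rewrite mulrAC.
have tmon : monoid_morphism t.
  split; first by rewrite -[X in t X](rmorph1 phi) tphi rmorph1.
  move=> x y; have [u [s [Ss xu]]] := localization_frac x.
  have [v [s' [Ss' yv]]] := localization_frac y.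
  apply: (mulIr (Spsi _ (SM _ _ Ss Ss'))).
  rewrite (tP _ (u * v) _ (SM _ _ Ss Ss')); last first.
    by rewrite !rmorphM /= mulrACA xu yv.
  by rewrite !rmorphM /= [RHS]mulrACA (tP _ _ _ Ss xu) (tP _ _ _ Ss' yv).
pose t' : {lrmorphism D -> D} := HB.pack t
  (GRing.isLinear.Build K D D *:%R _ tlin) (GRing.isMonoidMorphism.Build D D _ tmon).
by exists t'.
Qed.

Lemma uh_translation (mu : V -> K) : linear (mu : V -> K^o) ->
  exists psi : {lrmorphism Uh -> D}, forall h, psi (iUh h) = phi (iUh h) + (mu h)%:A.
Proof.
move=> mulin; pose f h : D := phi (iUh h) + (mu h)%:A.
have flin : linear f.
  move=> a x y; rewrite /f mulin !linearP /= scalerDr -addrACA; congr (_ + _).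
  by rewrite scalerDl scalerA.
pose fl : {linear abelian_lie V -> D} := HB.pack f (GRing.isLinear.Build K V D *:%R f flin).
have flie : is_lie_hom fl.
  move=> x y; rewrite [fl y * _]mulrC subrr; exact: linear0.
by have [_ /(_ _ fl flie) [psi [psiE _]]] := hUh; exists psi.
Qed.
End Localization.

(** * Derivations and sl2-modules *)

(** [op] stands both for the product of an algebra and for a Lie bracket. *)
Section AdNilpotent.
Variables (V : zmodType) (op : V -> V -> V) (d : V -> V).
Hypotheses (op0 : forall x, op x 0 = 0) (opr0 : forall x, op 0 x = 0).
Hypotheses (d0 : d 0 = 0) (dD : forall x y, d (x + y) = d x + d y).
Hypothesis dop : forall x y, d (op x y) = op (d x) y + op x (d y).

Lemma iter_additive n x y : iter n d (x + y) = iter n d x + iter n d y.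
Proof. by elim: n => //= n ->. Qed.

Lemma iter_zero n : iter n d 0 = 0.
Proof. by elim: n => //= n ->. Qed.

Lemma iter_zero_le m n x : (m <= n)%N -> iter m d x = 0 -> iter n d x = 0.
Proof. by move=> /subnK <- dx; rewrite iterD dx iter_zero. Qed.

Lemma derivation_nilpotent_prod m n x y : iter m d x = 0 -> iter n d y = 0 ->
  iter (m + n) d (op x y) = 0.
Proof.
have [N] := ubnP (m + n)%N; elim: N m n x y => // N IH m n x y.
case: m => [|m]; first by move=> _ /= -> _; rewrite opr0 iter_zero.
case: n => [|n]; first by move=> _ _ /= ->; rewrite op0 iter_zero.
rewrite ltnS => le_mnN dx dy.
have dx' : iter m d (d x) = 0 by rewrite -iterSr.
have dy' : iter n d (d y) = 0 by rewrite -iterSr.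
rewrite addSn iterSr dop iter_additive (IH m n.+1) //.
by rewrite -addSnnS (IH m.+1 n) ?addr0 //; move: le_mnN; rewrite !(addSn, addnS); lia.
Qed.

End AdNilpotent.

Section AdOp.
Variables (K : fieldType) (A : algType K).
Implicit Types x y a b : A.

Lemma ad_opP (b : A) : linear (ad_op b).
Proof.
move=> c x y; rewrite /ad_op mulrDr mulrDl -scalerAr -scalerAl scalerBr.
by rewrite opprD addrACA.
Qed.

HB.instance Definition _ (b : A) :=
  GRing.isLinear.Build K A A *:%R (ad_op b) (ad_opP b).

Lemma ad_opE b x : ad_op b x = b * x - x * b.
Proof. by []. Qed.

Lemma ad_opM b x y : ad_op b (x * y) = ad_op b x * y + x * ad_op b y.
Proof.
by rewrite /ad_op mulrBl mulrBr !mulrA addrA subrK.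
Qed.

Lemma ad_opN b x : ad_op (- b) x = - ad_op b x.
Proof. by rewrite /ad_op mulNr mulrN opprK opprB addrC. Qed.

Lemma ad_opZl c b x : ad_op (c *: b) x = c *: ad_op b x.
Proof. by rewrite /ad_op -scalerAl -scalerAr scalerBr. Qed.

Lemma mulr_ad b x : b * x = ad_op b x + x * b.
Proof. by rewrite /ad_op subrK. Qed.

Lemma ad_op_ad a b x :
  ad_op a (ad_op b x) = ad_op b (ad_op a x) + ad_op (ad_op a b) x.
Proof.
rewrite -[ad_op b x]/(b * x - x * b) linearB /= !ad_opM.
by rewrite (addrC (_ * x)) opprD addrACA.
Qed.
End AdOp.

Section LieTheory.
Variables (K : fieldType) (L : lieAlgebra K).
Implicit Types x y z : L.

Lemma bracket_linear x : linear (bracket x).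
Proof. by move=> a y z; rewrite bracketDr. Qed.

HB.instance Definition _ x := GRing.isLinear.Build K L L *:%R (bracket x) (bracket_linear x).

Lemma bracketC x y : bracket x y = - bracket y x.
Proof.
have l0 z : bracket 0 z = 0.
  have := bracketDl (-1) (0 : L) 0 z.
  by rewrite scaler0 addr0 scaleN1r addNr.
have lD u v z : bracket (u + v) z = bracket u z + bracket v z.
  by have := bracketDl 1 u v z; rewrite !scale1r.
apply/eqP; rewrite -subr_eq0 opprK.
by have := bracketxx (x + y); rewrite lD !linearD /= !bracketxx add0r addr0 => ->.
Qed.

Lemma bracket0l z : bracket 0 z = 0.
Proof. by rewrite bracketC linear0 oppr0. Qed.

Lemma bracketZl a x z : bracket (a *: x) z = a *: bracket x z.
Proof. by rewrite bracketC linearZ /= [bracket x z]bracketC scalerN. Qed.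

Lemma bracket_derivation x y z :
  bracket x (bracket y z) = bracket (bracket x y) z + bracket y (bracket x z).
Proof.
have := jacobi x y z; rewrite -addrA => /eqP; rewrite addr_eq0 => /eqP ->.
rewrite opprD addrC -[bracket (bracket x y) z]opprK -[in RHS]bracketC.
by rewrite (bracketC x z) [bracket y (- _)]linearN.
Qed.
End LieTheory.

Section SL2.
Variables (K : numFieldType) (V : lmodType K) (E F H : {linear V -> V}).
Hypotheses (EF : forall v, E (F v) = F (E v) + H v).
Hypothesis HF : forall v, H (F v) = F (H v) - 2%:R *: F v.
Hypothesis HE : forall v, H (E v) = E (H v) + 2%:R *: E v.

Lemma iter_linear0 (T : {linear V -> V}) n : iter n T 0 = 0.
Proof. by apply: iter_zero; rewrite linear0. Qed.

Lemma iter_linearZ (T : {linear V -> V}) n a v : iter n T (a *: v) = a *: iter n T v.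
Proof. by elim: n => //= n ->; rewrite linearZ. Qed.

Lemma sl2_F_weight n v l : H v = l *: v -> H (iter n F v) = (l - n.*2%:R) *: iter n F v.
Proof.
move=> Hv; elim: n => [|n IH]; first by rewrite subr0.
rewrite iterS HF IH linearZ /= -scalerBl doubleS -addn2 natrD.
by congr (_ *: _); ring.
Qed.

Lemma sl2_EFn n v l : H v = l *: v -> E (iter n.+1 F v) =
  iter n.+1 F (E v) + (n.+1%:R * (l - n%:R)) *: iter n F v.
Proof.
move=> Hv; elim: n => [|n IH]; first by rewrite /= EF Hv mul1r subr0.
rewrite iterS EF IH linearD linearZ /= -!iterS -addrA (sl2_F_weight n.+1 Hv) -scalerDl.
congr (_ + _ *: _); rewrite doubleS -addnn -[n.+2]addn2 -[n.+1]addn1 !natrD.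
by ring.
Qed.

(** On a highest weight vector, E F^(k + 1) v = (k + 1) (l - k) F^k v.  So the first
    power of F that kills v determines l. *)
Lemma sl2_highest_weight v l n : v != 0 -> E v = 0 -> H v = l *: v ->
  iter n F v = 0 -> exists m : nat, l = m%:R.
Proof.
move=> v0 Ev Hv; elim: n => [/= v0'|n IH Fv]; first by rewrite v0' eqxx in v0.
have := sl2_EFn n Hv; rewrite Fv Ev linear0 iter_linear0 add0r => /esym/eqP.
rewrite scaler_eq0 mulf_eq0 pnatr_eq0 /= subr_eq0 => /orP [/eqP ->|/eqP /IH //].
by exists n.
Qed.

Lemma sl2_integral v l : v != 0 -> H v = l *: v ->
  (exists n, iter n E v = 0) -> (forall u, exists n, iter n F u = 0) ->
  exists k : int, l = k%:~R.
Proof.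
move=> v0 Hv [n]; elim: n v l v0 Hv => [|n IH] v l v0 Hv En Fnil.
  by move: En => /= En; rewrite En eqxx in v0.
have [Ev|Ev] := eqVneq (E v) 0.
  have [m Fm] := Fnil v; have [k ->] := sl2_highest_weight v0 Ev Hv Fm.
  by exists k%:Z.
have [||k lk] // := IH (E v) (l + 2%:R) Ev _ _ Fnil.
- by rewrite HE Hv linearZ /= scalerDl.
- by rewrite -iterSr.
by exists (k - 2); rewrite rmorphB /= -lk addrK.
Qed.

(** The map F^m from the weight space m to the weight space -m is injective in an
    integrable module.  If F^m v = 0, then E v, of weight m + 2, is killed by F^(m + 2);
    so E v = 0 by induction on the order N at which E kills v, and one concludes as for
    highest weight vectors. *)
Lemma sl2_F_inj (m N : nat) v : H v = m%:R *: v -> iter N E v = 0 ->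
  iter m F v = 0 -> v = 0.
Proof.
elim: N m v => [//|N IH] m v Hv EN Fm.
have Ev : E v = 0.
  apply: (IH m.+2); first by rewrite HE Hv linearZ /= -scalerDl -natrD addn2.
    by rewrite -iterSr.
  have F1 : iter m.+1 F v = 0 by rewrite iterS Fm linear0.
  have F2 : iter m.+2 F v = 0 by rewrite iterS F1 linear0.
  by have := sl2_EFn m.+1 Hv; rewrite F2 F1 linear0 scaler0 addr0.
elim: {-2}m (leqnn m) Fm => [//|n IHn] le_nm Fn.
have := sl2_EFn n Hv; rewrite Fn Ev linear0 iter_linear0 add0r => /esym/eqP.
rewrite scaler_eq0 mulf_eq0 pnatr_eq0 /= subr_eq0 eqr_nat => /orP [|/eqP].
  by move/eqP=> mn; move: le_nm; rewrite mn ltnn.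
by apply: IHn; apply: ltnW.
Qed.
End SL2.

(** * Weight vectors and integral combinations of simple roots *)

Section Roots.
Variables (K : numFieldType) (g : kacMoody K).
Local Notation roots := Defs.roots.
Local Notation N := (km_size g).
Local Notation wt := (weight g).
Local Notation a_ i := (tnth (km_root g) i).
Local Notation hc i := (tnth (km_coroot g) i).
Implicit Types (x y z : g) (gam del : wt) (i j : 'I_N) (n : 'I_N -> int).

Lemma root_spaceD gam x y : root_space gam x -> root_space gam y -> root_space gam (x + y).
Proof. by move=> xP yP h; rewrite linearD /= xP yP scalerDr. Qed.

Lemma root_spaceZ gam (c : K) x : root_space gam x -> root_space gam (c *: x).
Proof. by move=> xP h; rewrite linearZ /= xP !scalerA mulrC. Qed.

Lemma root_space0 gam : root_space gam (0 : g).
Proof. by move=> h; rewrite linear0 scaler0. Qed.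

Lemma root_space_bracket gam del x y : root_space gam x -> root_space del y ->
  root_space (gam + del) (bracket x y).
Proof.
move=> xP yP h; rewrite bracket_derivation xP yP bracketZl linearZ /= -scalerDl.
by rewrite add_lfunE.
Qed.

Lemma root_space_iter gam del k x y : root_space gam x -> root_space del y ->
  root_space (gam *+ k + del) (iter k (bracket x) y).
Proof.
move=> xP yP; elim: k => [|k IH]; first by rewrite mulr0n add0r.
by rewrite iterS mulrS -addrA; apply: root_space_bracket.
Qed.

Lemma weight_neq gam del : gam != del -> exists h, gam h != del h.
Proof.
move=> gd; apply: contrapT => /forallNP eqh; case/eqP: gd.
by apply/lfunP => h; apply/eqP; apply: contrapT => /negP; exact: eqh.
Qed.

(** Weight vectors of distinct weights are independent: an element of the Cartan
    subalgebra that separates two of the weights eliminates one term of the sum. *)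
Lemma weight_independent gam (s : seq (wt * g)) x :
  (forall p, p \in s -> p.1 != gam /\ root_space p.1 p.2) ->
  root_space gam x -> x = \sum_(p <- s) p.2 -> x = 0.
Proof.
have [k] := ubnP (size s); elim: k s x => // k IH [|[del y] s] x /= ltsk sP xP xE.
  by rewrite xE big_nil.
have sP' p : p \in s -> p.1 != gam /\ root_space p.1 p.2.
  by move=> ps; apply: sP; rewrite inE ps orbT.
have [/= /weight_neq [h dgh] yP] := sP _ (mem_head _ _).
have nz : (gam h : K) - del h != 0 by rewrite subr_eq0 eq_sym.
apply: (scalerI nz); rewrite scaler0.
pose s' := map (fun p : wt * g => (p.1, (p.1 h - del h : K) *: p.2)) s.
apply: (IH s'); [by rewrite size_map| | |].
- move=> _ /mapP [p ps ->] /=; have [? ?] := sP' p ps.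
  by split=> //; apply: root_spaceZ.
- exact: root_spaceZ.
- rewrite scalerBl -xP xE linear_sum scaler_sumr -sumrB big_cons /= yP subrr add0r.
  transitivity (\sum_(p <- s') p.2) => //.
  rewrite big_map big_seq [RHS]big_seq; apply: eq_bigr => p ps /=.
  by have [_ ->] := sP' p ps; rewrite scalerBl.
Qed.

Lemma weight_component gam (s : seq (wt * g)) x :
  (forall p, p \in s -> root_space p.1 p.2) -> root_space gam x ->
  x = \sum_(p <- s) p.2 -> x = \sum_(p <- s | p.1 == gam) p.2.
Proof.
move=> sP xP xE; apply/eqP; rewrite -subr_eq0; apply/eqP.
apply: (@weight_independent gam [seq p <- s | p.1 != gam]).
- by move=> p; rewrite mem_filter => /andP [? /sP].
- apply: root_spaceD => //; rewrite -scaleN1r; apply: root_spaceZ.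
  rewrite big_seq_cond; elim/big_ind: _ => [||p]; [exact: root_space0|exact: root_spaceD|].
  by move=> /andP [/sP + /eqP <-].
rewrite big_filter {1}xE (bigID (fun p : wt * g => p.1 == gam)) /=.
by rewrite addrAC subrr add0r.
Qed.

Definition root_comb n : wt := \sum_i (n i)%:~R *: a_ i.
Definition single i (k : int) : 'I_N -> int := fun j => if j == i then k else 0.

Lemma root_combD n n' : root_comb (fun i => n i + n' i) = root_comb n + root_comb n'.
Proof. by rewrite /root_comb -big_split; apply: eq_bigr => i _; rewrite rmorphD scalerDl. Qed.

Lemma root_combN n : root_comb (fun i => - n i) = - root_comb n.
Proof. by rewrite /root_comb -sumrN; apply: eq_bigr => i _; rewrite rmorphN scaleNr. Qed.

Lemma root_comb_single i k : root_comb (single i k) = k%:~R *: a_ i.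
Proof.
rewrite /root_comb (bigD1 i) //= /single eqxx big1 ?addr0 // => j /negPf ->.
by rewrite scale0r.
Qed.

Lemma root_comb0 : root_comb (fun _ => 0) = 0.
Proof. by rewrite /root_comb big1 // => i _; rewrite scale0r. Qed.

Lemma eq_root_comb n n' : n =1 n' -> root_comb n = root_comb n'.
Proof. by move=> e; apply: eq_bigr => i _; rewrite e. Qed.

Lemma root_coord_comb i n : root_coord i (root_comb n) = (n i)%:~R.
Proof.
rewrite /root_coord /root_comb.
under eq_bigr => j _ do rewrite (tnth_nth 0).
by rewrite coord_sum_free // km_root_free.
Qed.

Lemma root_comb_inj n n' : root_comb n = root_comb n' -> n =1 n'.
Proof.
move=> e i; apply/eqP; rewrite -(eqr_int K).
by rewrite -!root_coord_comb e.
Qed.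

Definition pairing n j : int := \sum_i n i * cartan j i.

Lemma root_comb_coroot n j : root_comb n (hc j) = (pairing n j)%:~R.
Proof.
rewrite sum_lfunE rmorph_sum; apply: eq_bigr => i _.
by rewrite scale_lfunE km_pairing rmorphM.
Qed.

Lemma simple_refl_comb i n :
  simple_refl i (root_comb n) = root_comb (fun j => n j - single i (pairing n i) j).
Proof. by rewrite root_combD root_combN root_comb_single /simple_refl root_comb_coroot. Qed.

(** * The triangular decomposition *)

Definition chevalley (b : bool) i : g := if b then km_e i else km_f i.
Definition sign_of (b : bool) : int := if b then 1 else -1.
Definition iter_bracket b j (s : seq 'I_N) : g :=
  foldr (fun i => bracket (chevalley b i)) (chevalley b j) s.
Definition iter_bracket_wt b j (s : seq 'I_N) : 'I_N -> int :=
  fun i => sign_of b * (count_mem i (j :: s))%:Z.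

Lemma chevalley_root_space b i : root_space (root_comb (single i (sign_of b))) (chevalley b i).
Proof.
move=> h; rewrite root_comb_single scale_lfunE /chevalley /sign_of.
by case: b; rewrite ?km_he ?km_hf ?scale1r ?rmorphN1 ?scaleN1r.
Qed.

Lemma iter_bracket_root_space b j s :
  root_space (root_comb (iter_bracket_wt b j s)) (iter_bracket b j s).
Proof.
elim: s => [|i s IH].
  rewrite (@eq_root_comb _ (single j (sign_of b))); first exact: chevalley_root_space.
  move=> k; rewrite /iter_bracket_wt /single /= addn0 eq_sym; case: eqP => _; rewrite ?mulr1 ?mulr0 //.
rewrite (@eq_root_comb _ (fun k => single i (sign_of b) k + iter_bracket_wt b j s k)) ?root_combD.
  by apply: root_space_bracket => //; apply: chevalley_root_space.
move=> k; rewrite /iter_bracket_wt /single /= [i == k]eq_sym; case: (k == i) => /=; last by rewrite add0r.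
by rewrite addnCA PoszD mulrDr mulr1.
Qed.

(** Linear combinations of elements for which the triangular decomposition is manifest;
    [triangular_total] shows that these are all the elements. *)
Inductive in_triangular : g -> Prop :=
| triangular_h h : in_triangular (incl h)
| triangular_iter b j s : in_triangular (iter_bracket b j s)
| triangular_lin c x y : in_triangular x -> in_triangular y -> in_triangular (c *: x + y).

Inductive in_borel b : g -> Prop :=
| borel_h h : in_borel b (incl h)
| borel_iter j s : in_borel b (iter_bracket b j s)
| borel_lin c x y : in_borel b x -> in_borel b y -> in_borel b (c *: x + y).

Lemma in_borel_triangular b x : in_borel b x -> in_triangular x.
Proof. by elim=> *; [exact: triangular_h|exact: triangular_iter|exact: triangular_lin]. Qed.

Lemma in_borel0 b : in_borel b 0.
Proof. by rewrite -(linear0 (incl : {linear _ -> g})); apply: borel_h. Qed.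

Lemma in_borelZ b c x : in_borel b x -> in_borel b (c *: x).
Proof. by move=> bx; rewrite -[_ *: _]addr0; apply: borel_lin => //; apply: in_borel0. Qed.

Lemma in_triangular0 : in_triangular 0. Proof. exact: in_borel_triangular (in_borel0 true). Qed.

Lemma in_triangularZ c x : in_triangular x -> in_triangular (c *: x).
Proof.
by move=> bx; rewrite -[_ *: _]addr0; apply: triangular_lin => //; apply: in_triangular0.
Qed.

Lemma in_borelD b x y : in_borel b x -> in_borel b y -> in_borel b (x + y).
Proof. by move=> bx yb; rewrite -[x]scale1r; apply: borel_lin. Qed.

Lemma borel_bracket_cartan b h x : in_borel b x -> in_borel b (bracket (incl h) x).
Proof.
elim=> [h'|j s|c y z _ yb _ zb]; first by rewrite km_hh; apply: in_borel0.
  by rewrite iter_bracket_root_space; apply/in_borelZ/borel_iter.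
by rewrite linearD linearZ /=; apply: borel_lin.
Qed.

Lemma chevalley_bracket_cartan b i h :
  exists c, bracket (chevalley b i) (incl h) = c *: chevalley b i.
Proof. by rewrite bracketC chevalley_root_space -scaleNr; eexists. Qed.

Lemma borel_bracket b i x : in_borel b x -> in_borel b (bracket (chevalley b i) x).
Proof.
elim=> [h|j s|c y z _ yb _ zb].
- by have [c ->] := chevalley_bracket_cartan b i h; apply/in_borelZ/(borel_iter b i [::]).
- exact: (borel_iter b j (i :: s)).
by rewrite linearD linearZ /=; apply: borel_lin.
Qed.

Lemma chevalley_bracket_opposite b i j :
  exists h, bracket (chevalley b i) (chevalley (~~ b) j) = incl h.
Proof.
case: b => /=; last rewrite bracketC; rewrite km_ef; case: eqP => _.
- by eexists.
- by exists 0; rewrite linear0.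
- by eexists; rewrite -linearN.
- by exists 0; rewrite oppr0 linear0.
Qed.

(** By induction on [s], since a bracket of opposite generators is in the Cartan
    subalgebra: this makes [in_triangular] stable under all generators. *)
Lemma borel_bracket_opposite b i j s :
  in_borel (~~ b) (bracket (chevalley b i) (iter_bracket (~~ b) j s)).
Proof.
elim: s => [|k s IH] /=; first by have [h ->] := chevalley_bracket_opposite b i j; apply: borel_h.
rewrite bracket_derivation; apply: in_borelD; last exact: borel_bracket.
by have [h ->] := chevalley_bracket_opposite b i k; apply/borel_bracket_cartan/borel_iter.
Qed.

Lemma triangular_chevalley b i x : in_triangular x -> in_triangular (bracket (chevalley b i) x).
Proof.
elim=> [h|b' j s|c y z _ yb _ zb].
- by apply/(@in_borel_triangular b)/borel_bracket/borel_h.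
- have [->|nb] := eqVneq b' b; first by apply/(@in_borel_triangular b)/borel_bracket/borel_iter.
  have -> : b' = ~~ b by move: nb; case: b; case: b'.
  exact/in_borel_triangular/borel_bracket_opposite.
by rewrite linearD linearZ /=; apply: triangular_lin.
Qed.

Lemma triangular_cartan h x : in_triangular x -> in_triangular (bracket (incl h) x).
Proof.
elim=> [h'|b j s|c y z _ yb _ zb]; first by rewrite km_hh; apply: in_triangular0.
  by rewrite iter_bracket_root_space; apply/in_triangularZ/triangular_iter.
by rewrite linearD linearZ /=; apply: triangular_lin.
Qed.

(** The elements whose adjoint action preserves the span form a subalgebra by the Jacobi
    identity, and it contains the generators. *)
Lemma triangular_ideal x y : in_triangular y -> in_triangular (bracket x y).
Proof.
move: x y; apply: (@km_generated _ g
  [set x | forall y, in_triangular y -> in_triangular (bracket x y)]).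
- split=> [y _|c x y xT yT z zT|x y xT yT z zT] /=.
  + by rewrite bracket0l; apply: in_triangular0.
  + by rewrite bracketDl; apply: triangular_lin; [apply: xT|apply: yT].
  have -> : bracket (bracket x y) z = (-1) *: bracket y (bracket x z) + bracket x (bracket y z).
    by rewrite (bracket_derivation x y z) scaleN1r addrCA addNr addr0.
  by apply: triangular_lin; [apply/yT/xT|apply/xT/yT].
- by move=> h y; apply: triangular_cartan.
- by move=> i y; apply: (triangular_chevalley true).
- by move=> i y; apply: (triangular_chevalley false).
Qed.

Lemma triangular_total x : in_triangular x.
Proof.
move: x; apply: (@km_generated _ g in_triangular).
- by split=> *; [exact: in_triangular0|exact: triangular_lin|exact: triangular_ideal].
- exact: triangular_h.
- by move=> i; apply: (triangular_iter true i [::]).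
- by move=> i; apply: (triangular_iter false i [::]).
Qed.

Definition basic_vector gam x := (gam = 0 /\ exists h, x = incl h) \/
  exists b j s c, gam = root_comb (iter_bracket_wt b j s) /\ x = c *: iter_bracket b j s.

Lemma basic_root_space gam x : basic_vector gam x -> root_space gam x.
Proof.
case=> [[-> [h ->]] h'|[b [j [s [c [-> ->]]]]]].
  by rewrite km_hh zero_lfunE scale0r.
by apply/root_spaceZ/iter_bracket_root_space.
Qed.

Lemma basic_vectorZ gam c x : basic_vector gam x -> basic_vector gam (c *: x).
Proof.
case=> [[-> [h ->]]|[b [j [s [c' [-> ->]]]]]]; [left|right].
  by split=> //; exists (c *: h); rewrite linearZ.
by exists b, j, s, (c * c'); rewrite scalerA.
Qed.

Lemma triangular_decomposition x : exists s : seq (wt * g),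
  (forall p, p \in s -> basic_vector p.1 p.2) /\ x = \sum_(p <- s) p.2.
Proof.
elim: (triangular_total x) => [h|b j s|c y z _ [s [sP ->]] _ [t [tP ->]]].
- exists [:: (0, incl h)]; rewrite big_seq1; split=> // p; rewrite inE => /eqP -> /=.
  by left; split=> //; exists h.
- exists [:: (root_comb (iter_bracket_wt b j s), iter_bracket b j s)]; rewrite big_seq1; split=> // p.
  by rewrite inE => /eqP -> /=; right; exists b, j, s, 1; rewrite scale1r.
exists ([seq (p.1, c *: p.2) | p <- s] ++ t); split=> [p|].
  by rewrite mem_cat => /orP [/mapP [q /sP qP ->]|/tP //]; apply: basic_vectorZ.
by rewrite big_cat big_map /= scaler_sumr.
Qed.

Lemma root_space_basic gam x : root_space gam x ->
  exists s : seq g, (forall y, y \in s -> basic_vector gam y) /\ x = \sum_(y <- s) y.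
Proof.
have [s [sP xE]] := triangular_decomposition x => xP.
rewrite (weight_component _ xP xE); last by move=> p /sP /basic_root_space.
exists [seq p.2 | p <- s & p.1 == gam]; split; last by rewrite big_map big_filter.
by move=> _ /mapP [p + ->]; rewrite mem_filter => /andP [/eqP <- /sP].
Qed.

(** In particular all the coefficients of a root on the simple roots have the same
    sign. *)
Lemma roots_iter_bracket gam : roots gam -> exists b j s, gam = root_comb (iter_bracket_wt b j s).
Proof.
move=> [g0 [x xP x0]]; have [s [sP xE]] := root_space_basic xP.
case: s sP xE => [|y s] sP xE; first by rewrite xE big_nil eqxx in x0.
case: (sP y (mem_head _ _)) => [[e _]|[b [j [t [c [e _]]]]]]; last by exists b, j, t.
by rewrite e eqxx in g0.
Qed.

Lemma roots_comb gam : roots gam -> exists n, gam = root_comb n.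
Proof. by move=> /roots_iter_bracket [b [j [s ->]]]; eexists. Qed.

Lemma root_positive n i : roots (root_comb n) -> 0 < n i -> pos_roots (root_comb n).
Proof.
move=> rn ni; split=> //.
have [b [j [s e]]] := roots_iter_bracket rn; have {e} nE := root_comb_inj e.
case: b nE => nE; last by move: ni; rewrite nE /iter_bracket_wt mulN1r oppr_gt0 ltz_nat ltn0.
exists (fun k => count_mem k (j :: s)).
by rewrite /root_comb; apply: eq_bigr => k _; rewrite nE /iter_bracket_wt mul1r.
Qed.

Lemma sign_of_neq0 b : sign_of b != 0. Proof. by case: b. Qed.

Lemma iter_bracket_wt_single b j s i m : iter_bracket_wt b j s =1 single i m ->
  j :: s = nseq (size s).+1 i /\ m = sign_of b * (size s).+1%:Z.
Proof.
move=> e; have js : j :: s = nseq (size (j :: s)) i.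
  apply/all_pred1P/allP => k ks; apply/eqP; apply: contrapT => /eqP/negPf ki.
  have := e k; rewrite /iter_bracket_wt /single ki => /eqP; rewrite mulf_eq0 (negPf (sign_of_neq0 b)) /=.
  by rewrite -[_ == 0]/(count_mem k (j :: s) == 0)%N -leqn0 leqNgt -has_count has_pred1 ks.
split=> //; have := e i; rewrite /iter_bracket_wt js count_nseq [size _]/= /single eqxx => <-.
by rewrite /= eqxx mul1n.
Qed.

Lemma simple_root_space b i x :
  root_space (root_comb (single i (sign_of b))) x -> exists c, x = c *: chevalley b i.
Proof.
move=> /root_space_basic [s [sP ->]].
rewrite big_seq; elim/big_ind: _ => [|y z [c ->] [c' ->]|y /sP].
- by exists 0; rewrite scale0r.
- by exists (c + c'); rewrite scalerDl.
case=> [[]|[b' [j [t [c [/root_comb_inj e ->]]]]]].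
  rewrite -root_comb0 => /root_comb_inj/(_ i); rewrite /single eqxx => /eqP.
  by rewrite (negPf (sign_of_neq0 b)).
have {e} e : iter_bracket_wt b' j t =1 single i (sign_of b) by move=> k; rewrite -e.
have [[-> tE] sE] := iter_bracket_wt_single e.
have sign_eq (b1 b2 : bool) k : sign_of b1 = sign_of b2 * k.+1%:Z -> b1 = b2 /\ k = 0%N.
  by case: b1; case: b2 => // /eqP; case: k.
have [-> t0] := sign_eq _ _ _ sE.
by exists c; rewrite tE t0.
Qed.

Lemma iter_bracket_nseq b i k : iter_bracket b i (nseq k.+1 i) = 0.
Proof.
elim: k => [|k IH]; first exact: bracketxx.
by rewrite -[LHS]/(bracket (chevalley b i) (iter_bracket b i (nseq k.+1 i))) IH linear0.
Qed.

(** An iterated bracket whose weight is a multiple of one simple root involves a single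
    generator, and vanishes unless it is that generator. *)
Lemma simple_root_multiple i m : roots (root_comb (single i m)) -> m = 1 \/ m = -1.
Proof.
move=> [g0 [x /root_space_basic [s [sP xE]] /eqP x0]]; apply: contrapT => m1; apply: x0.
rewrite xE big_seq; apply: big1 => y /sP.
case=> [[e]|[b [j [t [c [/root_comb_inj e ->]]]]]]; first by rewrite e eqxx in g0.
have [[-> tE] mE] := iter_bracket_wt_single (fun k => esym (e k)).
case tn: (size t) => [|k]; last by rewrite tE tn iter_bracket_nseq scaler0.
by case: m1; rewrite mE tn mulr1; case: (b); [left|right].
Qed.
End Roots.

(** * Simple reflections and the Weyl group *)

Section Weyl.
Variables (K : numFieldType) (g : kacMoody K).
Local Notation roots := Defs.roots.
Local Notation N := (km_size g).
Local Notation wt := (weight g).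
Local Notation a_ i := (tnth (km_root g) i).
Local Notation hc i := (tnth (km_coroot g) i).
Implicit Types (x y z : g) (gam del : wt) (i j : 'I_N) (n : 'I_N -> int).

Lemma chevalley_ad_nilpotent_chevalley b i b' j :
  exists k, iter k (bracket (chevalley b i)) (chevalley b' j : g) = 0.
Proof.
have [->|nb] := eqVneq b' b.
  have [->|ij] := eqVneq j i; first by exists 1%N; rewrite /= bracketxx.
  exists `|1 - cartan i j|%N; rewrite eq_sym in ij.
  by case: b; [apply: km_serre_e|apply: km_serre_f].
have -> : b' = ~~ b by move: nb; case: b; case: b'.
exists 3%N; rewrite /=; have [h ->] := chevalley_bracket_opposite b i j.
have [c ->] := chevalley_bracket_cartan b i h.
by rewrite linearZ /= bracketxx scaler0.
Qed.

Lemma bracket_nil_subalgebra x : is_subalgebra [set y : g | exists k, iter k (bracket x) y = 0].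
Proof.
have b0 : bracket x 0 = 0 by rewrite linear0.
have bD y z : bracket x (y + z) = bracket x y + bracket x z by rewrite linearD.
split=> [|c y z [k yk] [l zl]|y z [k yk] [l zl]] /=; first by exists 0%N.
  exists (maxn k l); rewrite iter_additive // iter_linearZ.
  rewrite (iter_zero_le b0 (leq_maxl k l) yk) scaler0 add0r.
  exact: iter_zero_le (leq_maxr k l) zl.
exists (k + l)%N; apply: derivation_nilpotent_prod => //.
- by move=> u; rewrite linear0.
- by move=> u; rewrite bracket0l.
- exact: bracket_derivation.
Qed.

Lemma chevalley_ad_nilpotent b i x : exists k, iter k (bracket (chevalley b i)) x = 0.
Proof.
move: x; apply: (km_generated (bracket_nil_subalgebra (chevalley b i))).
- move=> h /=; exists 2%N; rewrite /=; have [c ->] := chevalley_bracket_cartan b i h.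
  by rewrite linearZ /= bracketxx scaler0.
- by move=> j; apply: (chevalley_ad_nilpotent_chevalley b i true).
- by move=> j; apply: (chevalley_ad_nilpotent_chevalley b i false).
Qed.

Lemma simple_reflK i : involutive (@simple_refl K g i).
Proof.
move=> l; rewrite /simple_refl !add_lfunE !opp_lfunE !scale_lfunE km_pairing cartan_diag.
rewrite -addrA -opprD -scalerDl.
set u := l _; rewrite (_ : u + (u - u *: 2%:~R) = 0) ?scale0r ?subr0 //.
by rewrite -[u *: _]/(u * _); ring.
Qed.

Lemma simple_refl_linear i : linear (@simple_refl K g i).
Proof.
move=> c u v; rewrite /simple_refl add_lfunE scale_lfunE scalerDl scalerBr scalerA.
by rewrite opprD addrACA.
Qed.

Lemma chevalley_bracket_coroot b i :
  bracket (chevalley b i) (chevalley (~~ b) i) = incl ((sign_of b)%:~R *: hc i).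
Proof.
case: b; rewrite /= ?km_ef ?eqxx ?scale1r //.
by rewrite bracketC km_ef eqxx -linearN scaleN1r.
Qed.

Lemma coroot_bracket_chevalley b b' i : bracket (incl ((sign_of b)%:~R *: hc i)) (chevalley b' i)
  = (sign_of b * sign_of b' * 2)%:~R *: chevalley b' i.
Proof.
rewrite chevalley_root_space root_comb_single scale_lfunE linearZ /= km_pairing cartan_diag.
congr (_ *: _); rewrite -[LHS]/((sign_of b')%:~R * ((sign_of b)%:~R * 2%:~R) : K).
by rewrite !rmorphM /= mulrCA mulrA.
Qed.

(** The map is the power of e_i or f_i which sends the weight of [x] to the reflected one;
    its injectivity is [sl2_F_inj] for the sl2 of the simple root, applied to the adjoint
    representation.  It transports both the existence of root vectors and the dimension
    of root spaces. *)
Lemma refl_map i n : exists T : {linear g -> g}, forall x, root_space (root_comb n) x ->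
  root_space (simple_refl i (root_comb n)) (T x) /\ (T x = 0 -> x = 0).
Proof.
have [b [m nE]] : exists b (m : nat), pairing n i = sign_of b * m%:Z.
  by case: (pairing n i) => m; [exists true, m|exists false, m.+1]; rewrite ?mul1r ?mulN1r ?NegzE.
pose T := iter m (bracket (chevalley (~~ b) i : g)).
have Tlin : linear T.
  by rewrite /T; elim: m {nE T} => [|k IH] c u v //=; rewrite IH linearP.
pose Tl : {linear g -> g} := HB.pack T (GRing.isLinear.Build K g g *:%R T Tlin).
exists Tl => x xP; split.
  have := root_space_iter m (chevalley_root_space (~~ b) i) xP; congr (root_space _ _).
  rewrite root_comb_single addrC /simple_refl root_comb_coroot nE -scaler_nat scalerA -scaleNr.
  by congr (_ + _ *: _); rewrite rmorphM /=; case: (b); rewrite /= ?rmorphN1 ?rmorph1; ring.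
have [k xk] := chevalley_ad_nilpotent b i x.
pose E : {linear g -> g} := bracket (chevalley b i : g).
pose F : {linear g -> g} := bracket (chevalley (~~ b) i : g).
pose H : {linear g -> g} := bracket (incl ((sign_of b)%:~R *: hc i) : g).
apply: (@sl2_F_inj K g E F H _ _ _ m k x _ xk) => [v|v|v|].
- by rewrite /E /F /H /= bracket_derivation chevalley_bracket_coroot addrC.
- rewrite /F /H /= bracket_derivation coroot_bracket_chevalley bracketZl addrC -scaleNr.
  by congr (_ + _ *: _); case: (b).
- rewrite /E /H /= bracket_derivation coroot_bracket_chevalley bracketZl addrC.
  by congr (_ + _ *: _); case: (b).
rewrite /H /= xP linearZ /= root_comb_coroot nE; congr (_ *: _).
rewrite -[LHS]/((sign_of b)%:~R * (sign_of b * m)%:~R : K) rmorphM /= mulrA.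
by case: (b); rewrite /= ?rmorphN1 ?mulrNN !mul1r.
Qed.

Lemma refl_root i gam : roots gam -> roots (simple_refl i gam).
Proof.
move=> rg; have [n nE] := roots_comb rg; move: rg; rewrite nE => -[g0 [x xP /eqP x0]].
have [T /(_ x xP) [TP Tinj]] := refl_map i n; split.
  apply: contra_neq g0 => /(congr1 (simple_refl i)); rewrite simple_reflK => ->.
  by rewrite /simple_refl zero_lfunE scale0r subr0.
by exists (T x) => //; apply/eqP => /Tinj.
Qed.

(** Stated by linear dependence, and not by a spanning vector, so that it can be pulled
    back along an injective linear map. *)
Definition one_dim gam := forall x y, root_space gam x -> root_space gam y ->
  exists c d : K, (c != 0 \/ d != 0) /\ c *: x + d *: y = 0.

Lemma one_dim_simple b i : one_dim (root_comb (single i (sign_of b))).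
Proof.
move=> x y /simple_root_space [c ->] /simple_root_space [d ->].
have [->|c0] := eqVneq c 0.
  by exists 1, 0; rewrite !scale0r scaler0 addr0; split=> //; left; rewrite oner_neq0.
exists d, (- c); split; first by right; rewrite oppr_eq0.
by rewrite !scalerA mulNr mulrC scaleNr subrr.
Qed.

Lemma one_dim_refl i n : one_dim (root_comb n) -> one_dim (simple_refl i (root_comb n)).
Proof.
rewrite simple_refl_comb => dn x y xP yP; have [T TP] := refl_map i (fun j => n j - single i (pairing n i) j).
have [xT xI] := TP _ xP; have [yT yI] := TP _ yP.
move: xT yT; rewrite -simple_refl_comb simple_reflK => xT yT.
have [c [d [cd0 e]]] := dn _ _ xT yT; exists c, d; split=> //.
have [|_] := TP (c *: x + d *: y).
  by apply: root_spaceD; apply: root_spaceZ.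
by apply; rewrite linearD !linearZ /= e.
Qed.

Lemma weyl_linear w : in_weyl w -> linear (w : wt -> wt).
Proof.
by elim=> [//|i w' _ IH] c x y; rewrite /= IH simple_refl_linear.
Qed.

Section Weyl_w.
Variable w : wt -> wt.
Hypothesis hw : in_weyl w.

Lemma weylD (x y : wt) : w (x + y) = w x + w y.
Proof. by have := weyl_linear hw 1 x y; rewrite !scale1r. Qed.

Lemma weyl0 : w 0 = 0.
Proof. by apply: (addrI (w 0)); rewrite -weylD !addr0. Qed.

Lemma weylN (x : wt) : w (- x) = - w x.
Proof. by apply/eqP; rewrite -addr_eq0 -weylD addNr weyl0. Qed.

Lemma weyl_comb n : exists n', w (root_comb n) = root_comb n'.
Proof.
elim: hw n => [|i w' _ IH] n; first by exists n.
by have [n' /= ->] := IH n; rewrite simple_refl_comb; eexists.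
Qed.

Lemma weyl_comb_surj n : exists n', root_comb n = w (root_comb n').
Proof.
elim: hw n => [|i w' _ IH] n; first by exists n.
have [n' e] := IH (fun j => n j - single i (pairing n i) j); exists n' => /=.
by rewrite -e -simple_refl_comb simple_reflK.
Qed.

Lemma weyl_inj gam : w gam = 0 -> gam = 0.
Proof.
elim: hw => [//|i w' _ IH] /= /(congr1 (simple_refl i)); rewrite simple_reflK => e.
by apply: IH; rewrite e /simple_refl zero_lfunE scale0r subr0.
Qed.

Lemma weyl_rootsV gam : roots (w gam) -> roots gam.
Proof.
elim: hw => [//|i w' _ IH] /= /(refl_root i); rewrite simple_reflK.
exact: IH.
Qed.

Lemma one_dim_weyl n : one_dim (root_comb n) -> one_dim (w (root_comb n)).
Proof.
elim: hw => [//|i w' hw' IH] /IH /=.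
suff [n' ->] : exists n', w' (root_comb n) = root_comb n' by apply: one_dim_refl.
elim: hw' => [|i' w'' _ [n' /= ->]]; first by exists n.
by rewrite simple_refl_comb; eexists.
Qed.
End Weyl_w.

(** * Coroots and integral weights *)

Definition is_integer (c : K) := exists k : int, c = k%:~R.

Lemma is_integerD c d : is_integer c -> is_integer d -> is_integer (c + d).
Proof. by move=> [k ->] [l ->]; exists (k + l); rewrite rmorphD. Qed.

Lemma is_integerM c d : is_integer c -> is_integer d -> is_integer (c * d).
Proof. by move=> [k ->] [l ->]; exists (k * l); rewrite rmorphM. Qed.

Lemma is_integerN c : is_integer c -> is_integer (- c).
Proof. by move=> [k ->]; exists (- k); rewrite rmorphN. Qed.

Lemma is_integer_sum (I : Type) (s : seq I) (c : I -> K) :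
  (forall k, is_integer (c k)) -> is_integer (\sum_(i <- s) c i).
Proof.
move=> cP; elim/big_ind: _ => // [|x y]; last exact: is_integerD.
by exists 0.
Qed.

Definition integral_wt gam := forall i, is_integer (gam (hc i)).
Definition integral_h (h : cartan_alg g) := forall gam, integral_wt gam -> is_integer (gam h).

Lemma integral_comb n : integral_wt (root_comb n).
Proof. by move=> i; exists (pairing n i); apply: root_comb_coroot. Qed.

Lemma t_comb n : t_ (root_comb n) = \sum_i ((n i)%:~R * (symm i)%:R) *: hc i.
Proof. by apply: eq_bigr => i _; rewrite root_coord_comb. Qed.

Lemma simple_root_t_comb n i : a_ i (t_ (root_comb n)) = (root_comb n (hc i) : K) * (symm i)%:R.
Proof.
rewrite t_comb linear_sum sum_lfunE /= mulr_suml; apply: eq_bigr => j _.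
rewrite linearZ /= scale_lfunE !km_pairing -[_ *: _]/(_ * _) -[X in _ = X * _]/(_ * _).
have := congr1 (fun k : int => k%:~R : K) (symmP j i); rewrite !rmorphM /= => e.
by rewrite -!mulrA; congr (_ * _); rewrite [RHS]mulrC.
Qed.

Lemma root_norm_comb n : root_norm (root_comb n) = root_comb n (t_ (root_comb n)).
Proof.
rewrite /root_norm exchange_big t_comb linear_sum /=.
rewrite [RHS](eq_bigr (fun i => \sum_j (n j)%:~R * (n i)%:~R * ((symm i)%:R * (cartan i j)%:~R))).
  rewrite [RHS]exchange_big /=; apply: eq_bigr => i _; apply: eq_bigr => j _.
  by rewrite !root_coord_comb (mulrC (n j)%:~R).
move=> i _; rewrite linearZ /= root_comb_coroot -[_ *: _]/(_ * _) /pairing rmorph_sum mulr_sumr.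
by apply: eq_bigr => j _; rewrite rmorphM /=; ring.
Qed.

(** The action of a simple reflection on the Cartan subalgebra, dual to its action on
    weights. *)
Definition corefl i (h : cartan_alg g) := h - (a_ i h : K) *: hc i.

Lemma simple_refl_corefl i gam h : simple_refl i gam (corefl i h) = gam h.
Proof.
rewrite /simple_refl /corefl add_lfunE opp_lfunE scale_lfunE !linearB !linearZ /=.
rewrite km_pairing cartan_diag -![_ *: _]/(_ * _).
by ring.
Qed.

Lemma corefl_integral i h : integral_h h -> integral_h (corefl i h).
Proof.
move=> hP gam gP; rewrite linearB linearZ /=; apply: is_integerD; first exact: hP.
apply/is_integerN/is_integerM; last exact: gP.
apply: hP => j; exists (cartan j i); exact: km_pairing.
Qed.

(** By the symmetry of the bilinear form, [simple_root_t_comb]. *)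
Lemma t_simple_refl i n : t_ (simple_refl i (root_comb n)) = corefl i (t_ (root_comb n)).
Proof.
rewrite /corefl simple_root_t_comb simple_refl_comb !t_comb root_comb_coroot.
rewrite [in RHS](bigD1 i) //= (bigD1 i) //= /single eqxx rmorphB mulrBl scalerBl /= addrAC.
congr (_ + _ - _); apply: eq_bigr => j /negPf ->; by rewrite subr0.
Qed.

Lemma t_simple_root i : t_ (a_ i) = (symm i)%:R *: hc i.
Proof.
rewrite -[a_ i]scale1r -(root_comb_single i 1) t_comb (bigD1 i) //= /single eqxx mul1r big1 ?addr0 //.
by move=> j /negPf ->; rewrite mul0r scale0r.
Qed.

Lemma weyl_coroot w : in_weyl w -> exists C : cartan_alg g -> cartan_alg g,
  [/\ forall gam h, w gam (C h) = gam h, forall n, t_ (w (root_comb n)) = C (t_ (root_comb n)),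
      forall c h, C (c *: h) = c *: C h & forall h, integral_h h -> integral_h (C h)].
Proof.
elim=> [|i w' hw [C [C1 C2 C3 C4]]]; first by exists id.
exists (corefl i \o C); split=> [gam h|n|c h|h hP] /=.
- by rewrite simple_refl_corefl.
- by rewrite -C2; have [n' ->] := weyl_comb hw n; rewrite t_simple_refl.
- by rewrite C3 /corefl (linearZZ (a_ i)) scalerBr scalerA.
- exact/corefl_integral/C4.
Qed.

(** The normalization 2 / (gamma, gamma) makes the coroot of the root [w (a_ i)] the image under
    w of the simple coroot, because the form is invariant. *)
Lemma coroot_weyl w i : in_weyl w ->
  (forall gam, w gam (h_ (w (a_ i))) = gam (hc i)) /\ integral_h (h_ (w (a_ i))).
Proof.
move=> hw; have [C [C1 C2 C3 C4]] := weyl_coroot hw.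
have aE : a_ i = root_comb (single i 1) by rewrite root_comb_single scale1r.
have -> : h_ (w (a_ i)) = C (hc i).
  rewrite /h_; case: asboolP => [_|[]]; last by exists i, w.
  have sn : (symm i)%:R != 0 :> K by rewrite pnatr_eq0 -lt0n symm_gt0.
  have -> : root_norm (w (a_ i)) = (symm i)%:R * 2.
    have [n wE] := weyl_comb hw (single i 1).
    rewrite aE wE root_norm_comb -wE C2 C1 -aE t_simple_root linearZ /= km_pairing cartan_diag.
    by [].
  rewrite aE C2 -aE t_simple_root C3 scalerA.
  rewrite (_ : _ * _ = 1) ?scale1r //; field; exact: sn.
split; first by move=> gam; apply: C1.
by apply: C4 => gam; apply.
Qed.

(** Coroots of real roots are images of simple coroots, and the [t_] of an imaginary root
    is an integral combination of simple coroots. *)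
Lemma roots_h_integral gam : roots gam -> integral_h (h_ gam).
Proof.
move=> rg; case: (pselect (real_roots gam)) => [[i [w [hw ->]]]|nr].
  by have [] := coroot_weyl i hw.
rewrite /h_; case: asboolP => // _; have [n ->] := roots_comb rg => del dP.
rewrite t_comb linear_sum; apply: is_integer_sum => i; rewrite linearZ /=.
apply: is_integerM; last exact: dP.
by exists (n i * symm i); rewrite rmorphM.
Qed.

Lemma refl_weyl w i gam : in_weyl w -> refl (w (a_ i)) (w gam) = w (simple_refl i gam).
Proof.
move=> hw; rewrite /refl; have [-> _] := coroot_weyl i hw.
by rewrite /simple_refl addrC -scaleNr -(weyl_linear hw) addrC scaleNr.
Qed.
End Weyl.

(** * The radical common to the two nilpotent subalgebras *)

Section Radical.
Variables (K : numFieldType) (g : kacMoody K).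
Local Notation roots := Defs.roots.
Local Notation N := (km_size g).
Local Notation wt := (weight g).
Local Notation a_ i := (tnth (km_root g) i).
Local Notation hc i := (tnth (km_coroot g) i).
Implicit Types (x y z : g) (gam del : wt) (j : 'I_N) (n : 'I_N -> int).
Variables (w : wt -> wt) (i : 'I_N).
Hypothesis hw : in_weyl w.
Local Notation alpha := (w (a_ i)).

Lemma simple_root_single : a_ i = root_comb (single i 1).
Proof. by rewrite root_comb_single scale1r. Qed.

Lemma simple_refl_simple_root : simple_refl i (a_ i) = - a_ i.
Proof.
rewrite /simple_refl km_pairing cartan_diag -{1}[a_ i]scale1r -scalerBl -scaleN1r.
by congr (_ *: _); ring.
Qed.

Lemma alpha_coroot : alpha (h_ alpha) = 2.
Proof. by have [-> _] := coroot_weyl i hw; rewrite km_pairing cartan_diag. Qed.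

(** A positive coefficient away from the [i]-th simple root is not affected by adding multiples
    of that root, nor by its reflection: so this set is stable under ad e and ad f, and lies in
    both subalgebras.  It spans the nilradical of the parabolic
    subalgebra attached to alpha. *)
Definition radical : set g :=
  [set z | exists n j, [/\ j != i, 0 < n j & root_space (w (root_comb n)) z]].

Lemma radical_bracket m x z : root_space (w (root_comb (single i m))) x -> radical z ->
  radical (bracket x z).
Proof.
move=> xP [n [j [ji nj zP]]]; exists (fun k => single i m k + n k), j; split=> //.
  by rewrite /single (negPf ji) add0r.
by rewrite root_combD weylD //; apply: root_space_bracket.
Qed.

Lemma radical_weight z : radical z -> exists n, root_space (w (root_comb n)) z.
Proof. by move=> [n [j []]]; exists n. Qed.

Lemma radical_root n j z : 0 < n j -> root_space (w (root_comb n)) z -> z != 0 ->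
  roots (root_comb n).
Proof.
move=> nj zP z0; apply: (weyl_rootsV hw); split; last by exists z.
apply/eqP => /(weyl_inj hw); rewrite -root_comb0 => /root_comb_inj/(_ j) e.
by rewrite e in nj.
Qed.

Lemma root_span1 (P : set wt) gam z : P gam -> root_space gam z -> root_span P z.
Proof.
move=> Pg zP; exists [:: z]; rewrite big_seq1; split=> // y.
by rewrite inE => /eqP ->; exists gam.
Qed.

Lemma root_span0 (P : set wt) : root_span P (0 : g).
Proof. by exists [::]; rewrite big_nil. Qed.

Lemma radical_nil_subalg z : radical z -> nil_subalg w z.
Proof.
move=> [n [j [ji nj zP]]]; have [->|z0] := eqVneq z 0; first exact: root_span0.
apply: (root_span1 _ zP); exists (root_comb n) => //.
exact: root_positive (radical_root nj zP z0) nj.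
Qed.

Lemma radical_nil_subalg_refl z : radical z -> nil_subalg (refl alpha \o w) z.
Proof.
move=> [n [j [ji nj zP]]]; have [->|z0] := eqVneq z 0; first exact: root_span0.
have rn := radical_root nj zP z0.
apply: (root_span1 _ zP); exists (simple_refl i (root_comb n)); last first.
  by rewrite /= refl_weyl // simple_reflK.
have := refl_root i rn; rewrite simple_refl_comb => /(@root_positive _ _ _ j); apply.
by rewrite /single (negPf ji) subr0.
Qed.

Variables e f : g.
Hypotheses (he : root_space alpha e) (hf : root_space (- alpha) f).
Hypothesis hef : bracket e f = incl (h_ alpha).

Lemma ef_nz : incl (h_ alpha) != 0 :> g.
Proof.
apply/eqP; rewrite -(linear0 (incl : {linear _ -> g})) => /incl_inj e0.
have := alpha_coroot; rewrite e0 linear0 => /eqP.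
by rewrite eq_sym pnatr_eq0.
Qed.

Lemma e_nz : e != 0.
Proof. by apply: contra_neq ef_nz => e0; rewrite -hef e0 bracket0l. Qed.

Lemma f_nz : f != 0.
Proof. by apply: contra_neq ef_nz => f0; rewrite -hef f0 linear0. Qed.

Lemma roots_alpha : roots alpha.
Proof.
split; last by exists e => //; exact: e_nz.
apply/eqP => a0; have := alpha_coroot; rewrite a0 zero_lfunE => /eqP.
by rewrite eq_sym pnatr_eq0.
Qed.

Lemma pos_simple_root : pos_roots (a_ i).
Proof.
have := weyl_rootsV hw roots_alpha; rewrite simple_root_single => /(@root_positive _ _ _ i); apply.
by rewrite /single eqxx.
Qed.

Lemma e_nil_subalg : nil_subalg w e.
Proof. by apply: root_span1 he; exists (a_ i) => //; exact: pos_simple_root. Qed.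

Lemma f_nil_subalg : nil_subalg (refl alpha \o w) f.
Proof.
apply: root_span1 hf; exists (a_ i); first exact: pos_simple_root.
by rewrite /= refl_weyl // simple_refl_simple_root weylN.
Qed.

Lemma one_dim_span gam y z : one_dim gam -> root_space gam y -> y != 0 ->
  root_space gam z -> exists c, z = c *: y.
Proof.
move=> d1 yP y0 zP; have [c [d [cd e0]]] := d1 z y zP yP.
have [c0|c0] := eqVneq c 0.
  move: cd e0; rewrite c0 eqxx scale0r add0r => -[//|d0] /eqP.
  by rewrite scaler_eq0 (negPf d0) (negPf y0).
exists (- c^-1 * d); apply: (scalerI c0).
move/eqP: e0; rewrite addr_eq0 => /eqP ->.
by rewrite !scalerA mulrA mulrN mulfV // mulN1r scaleNr.
Qed.

Lemma alpha_space z : root_space alpha z -> exists c, z = c *: e.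
Proof.
apply: one_dim_span he e_nz; rewrite simple_root_single; apply: one_dim_weyl => //.
exact: (@one_dim_simple _ _ true).
Qed.

Lemma Nalpha_space z : root_space (- alpha) z -> exists c, z = c *: f.
Proof.
apply: one_dim_span hf f_nz; rewrite -weylN // -scaleN1r.
have -> : -1 *: a_ i = root_comb (single i (-1)) by rewrite root_comb_single rmorphN1.
by apply: one_dim_weyl => //; apply: (@one_dim_simple _ _ false).
Qed.

(** The first case gives e (or f after the reflection), the second one the radical. *)
Lemma pos_root_cases gam : pos_roots gam ->
  gam = a_ i \/ exists n j, [/\ gam = root_comb n, j != i & 0 < n j].
Proof.
move=> [rg [m gE]]; pose n j : int := (m j)%:Z.
have {}gE : gam = root_comb n by rewrite gE.
have [/existsP [j /andP [ji mj]]|/existsPn m0] := boolP [exists j, (j != i) && (0 < m j)%N].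
  by right; exists n, j; rewrite ltz_nat.
left; have nE : n =1 single i (m i).
  move=> j; rewrite /n /single; case: eqP => [->//|/eqP ji].
  by have := m0 j; rewrite ji /= -leqNgt leqn0 => /eqP ->.
move: rg; rewrite gE (eq_root_comb nE) => /simple_root_multiple [->|//].
by rewrite -simple_root_single.
Qed.

Lemma nil_subalgP x : nil_subalg w x -> exists s : seq g,
  (forall v, v \in s -> (exists c, v = c *: e) \/ radical v) /\ x = \sum_(v <- s) v.
Proof.
move=> [s [sP ->]]; exists s; split=> // v /sP [_ [gam + <-] vP].
move=> /pos_root_cases [ga|[n [j [gE ji nj]]]]; [left|right].
  by apply: alpha_space; rewrite -ga.
by exists n, j; rewrite -gE.
Qed.

Lemma nil_subalg_reflP x : nil_subalg (refl alpha \o w) x -> exists s : seq g,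
  (forall v, v \in s -> (exists c, v = c *: f) \/ radical v) /\ x = \sum_(v <- s) v.
Proof.
move=> [s [sP ->]]; exists s; split=> // v /sP [_ [gam + <-] /= vP].
move: vP; rewrite refl_weyl // => vP.
move=> /pos_root_cases [ga|[n [j [gE ji nj]]]]; [left|right].
  by apply: Nalpha_space; rewrite -weylN // -simple_refl_simple_root -ga.
exists (fun k => n k - single i (pairing n i) k), j; rewrite -simple_refl_comb -gE.
by rewrite /single (negPf ji) subr0.
Qed.

Lemma pairing_single n j m :
  pairing (fun l => n l + single i m l) j = pairing n j + m * cartan j i.
Proof.
rewrite /pairing (eq_bigr (fun l => n l * cartan j l + if l == i then m * cartan j l else 0)).
  by rewrite big_split /= -big_mkcond big_pred1_eq.
by move=> l _; rewrite mulrDl /single; case: eqP => // _; rewrite mul0r.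
Qed.

(** For large k, a root n + k alpha_i has a positive coefficient at [i], hence all its
    coefficients are nonnegative.  If one of them is positive away from [i], it stays so after
    the reflection, whose coefficient at [i] decreases to minus infinity; otherwise the
    root is a multiple of alpha_i. *)
Lemma string_bounded n : exists k0 : nat, forall k : nat, (k0 <= k)%N ->
  root_comb (fun j => n j + single i k j) != 0 /\ ~ roots (root_comb (fun j => n j + single i k j)).
Proof.
exists (`|n i| + `|pairing n i| + 3)%N => k le_k.
set m := (fun j => _ + _); have mi : m i = n i + k by rewrite /m /single eqxx.
have mi_gt1 : 1 < m i by rewrite mi; lia.
split; first by apply/eqP; rewrite -root_comb0 => /root_comb_inj/(_ i) m0; rewrite m0 in mi_gt1.
move=> rm; have mi_gt0 : 0 < m i by apply: lt_trans mi_gt1.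
have [_ [p mp]] := root_positive rm mi_gt0.
have {mp} mp : m =1 (fun j => (p j)%:Z) by apply: root_comb_inj; rewrite mp.
have [/existsP [j /andP [ji pj]]|/existsPn p0] := boolP [exists j, (j != i) && (0 < p j)%N].
  have mj : 0 < m j by rewrite mp ltz_nat.
  have := refl_root i rm; rewrite simple_refl_comb => /(@root_positive _ _ _ j).
  rewrite {1}/single (negPf ji) subr0 => /(_ mj) [_ [q mq]].
  have := root_comb_inj (mq : _ = root_comb (fun j => (q j)%:Z)) i.
  have -> : pairing m i = pairing n i + k%:Z * 2 by rewrite pairing_single cartan_diag.
  by rewrite mi /single eqxx => qi; have : 0 <= (q i)%:Z :> int by []; rewrite -qi; lia.
have nE : m =1 single i (m i).
  move=> j; rewrite /single; case: eqP => [->//|/eqP ji].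
  by have := p0 j; rewrite mp ji /= -leqNgt leqn0 => /eqP ->.
by move: rm; rewrite (eq_root_comb nE) => /simple_root_multiple [] m1; rewrite m1 in mi_gt1.
Qed.

Lemma real_root_nilpotent x y : root_space alpha x -> exists k, iter k (bracket x) y = 0.
Proof.
move=> xP; have [s [sP ->]] := triangular_decomposition y.
have [S0 Slin _] := bracket_nil_subalgebra x.
rewrite big_seq; elim/big_ind: _ => [//|u v uS vS|[gam v] /sP /= vP].
  by have := Slin 1 u v uS vS; rewrite scale1r.
have [n gE] : exists n, gam = root_comb n.
  case: vP => [[-> _]|[b [j [t [c [-> _]]]]]]; last by eexists.
  by exists (fun=> 0); rewrite root_comb0.
have [n' nE] := weyl_comb_surj hw n.
have [k kP] := string_bounded n'; have [k0 kr] := kP _ (leqnn k).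
exists k; apply/eqP; apply: contrapT => /negP nz; apply: kr.
apply: (weyl_rootsV hw); split.
  by apply: contra_neq k0 => /(weyl_inj hw).
exists (iter k (bracket x) v) => //.
have := root_space_iter k xP (basic_root_space vP); congr (root_space _ _).
have wZ c u : w (c *: u) = c *: w u.
  by have := weyl_linear hw c u 0; rewrite !addr0 weyl0 // addr0.
by rewrite root_combD weylD // -nE gE addrC root_comb_single wZ -[alpha *+ k]scaler_nat.
Qed.
End Radical.

(** * The series in the localization of sl2 *)

Section DividedPowers.
Variable K : numFieldType.

Definition divsign n : K := (-1) ^+ n / n`!%:R.

Lemma divsign0 : divsign 0 = 1.
Proof. by rewrite /divsign expr0 fact0 divr1. Qed.

Lemma divsignS n : divsign n.+1 * n.+1%:R = - divsign n.
Proof.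
rewrite /divsign factS natrM exprS mulN1r -mulrA invfM mulrAC mulVf ?mul1r ?mulNr //.
by rewrite pnatr_eq0.
Qed.

Lemma divsignM k l : divsign (k + l) * 'C(k + l, k)%:R = divsign k * divsign l.
Proof.
have nz n : (n`!)%:R != 0 :> K by rewrite pnatr_eq0 -lt0n fact_gt0.
have := bin_fact (leq_addr l k); rewrite addKn => /(congr1 (fun n => n%:R : K)).
rewrite !natrM /divsign => <-.
have binnz : 'C(k + l, k)%:R != 0 :> K.
  by rewrite pnatr_eq0 -lt0n bin_gt0 leq_addr.
by rewrite exprD; field; rewrite !nz binnz.
Qed.

End DividedPowers.

Lemma sum_triangle (V : zmodType) (X : nat -> nat -> V) M :
  \sum_(n < M) \sum_(k < n.+1) X k (n - k)%N = \sum_(k < M) \sum_(l < M - k) X k l.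
Proof.
elim: M => [|M IH]; first by rewrite !big_ord0.
rewrite big_ord_recr /= IH.
under [in RHS]eq_bigr => k _.
  rewrite subSn; last by rewrite -ltnS.
  rewrite big_ord_recr /=.
  over.
rewrite big_split /= [in RHS]big_ord_recr /= subnn big_ord0 addr0; congr (_ + _).
Qed.

(** [A] is the admissible algebra, [B] its localization and [D] the localized Cartan part;
    [tau] is the translation by the weight of [e].  [M] is the radical, [X] and [Y] generate
    the left ideals of the two nilpotent subalgebras, and [r] chooses representatives of the
    values of q. *)
Section Operators.
Variables (K : numFieldType) (A B : algType K) (D : comUnitAlgType K).
Variables (iA : {lrmorphism A -> B}) (iD : {lrmorphism D -> B}).
Variables (e f : A) (H : D) (tau : {lrmorphism D -> D}).
Hypothesis iA_ef : iA (ad_op e f) = iD H.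
Hypothesis he : ad_op (ad_op e f) e = 2%:R *: e.
Hypothesis iA_f : forall d, iA f * iD d = iD (tau d) * iA f.
Hypothesis iA_e : forall d, iD d * iA e = iA e * iD (tau d).
Hypothesis tau_surj : forall d, exists d', tau d' = d.
Hypothesis tauH : tau H = H + 2%:R.
Hypothesis H_unit : forall k : int, H + k%:~R \is a GRing.unit.

Local Notation E := (iA e).
Local Notation F := (iA f).

Definition sl2_den n : D := \prod_(j < n) (H - j%:R).
Definition sl2_frac n : B := F ^+ n * iD (sl2_den n)^-1.

Lemma sl2_denS n : sl2_den n.+1 = sl2_den n * (H - n%:R).
Proof. by rewrite /sl2_den big_ord_recr. Qed.

Lemma H_unitN n : H - n%:R \is a GRing.unit.
Proof. by have := H_unit (- n%:Z); rewrite rmorphN. Qed.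

Lemma H_unitD n : H + n%:R \is a GRing.unit.
Proof. exact: H_unit n%:Z. Qed.

Lemma sl2_den_unit n : sl2_den n \is a GRing.unit.
Proof. by rewrite /sl2_den rpred_prod // => j _; apply: H_unitN. Qed.

Lemma sl2_denVS n : (H - n%:R) * (sl2_den n.+1)^-1 = (sl2_den n)^-1.
Proof.
by rewrite sl2_denS invrM ?sl2_den_unit ?H_unitN // mulrA mulrV ?H_unitN ?mul1r.
Qed.

Lemma sl2_frac0 : sl2_frac 0 = 1.
Proof. by rewrite /sl2_frac expr0 mul1r /sl2_den big_ord0 invr1 rmorph1. Qed.

Lemma Fexp_D n d : F ^+ n * iD d = iD (iter n tau d) * F ^+ n.
Proof.
elim: n => [|n IH]; first by rewrite !expr0 mul1r mulr1.
by rewrite exprS -mulrA IH mulrA iA_f -mulrA -exprS.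
Qed.

Lemma Fexp_H n k : F ^+ n * iD (H + k) = iD (H + (n.*2)%:R + iter n tau k) * F ^+ n.
Proof.
rewrite Fexp_D; congr (iD _ * _).
elim: n => [|n IH] /=; first by rewrite addr0.
by rewrite IH !rmorphD /= tauH rmorph_nat doubleS -addn2 natrD; ring.
Qed.

Lemma iter_tau_nat n k : iter n tau k%:R = k%:R.
Proof. by elim: n => //= n ->; rewrite rmorph_nat. Qed.

Lemma iter_tauN n d : iter n tau (- d) = - iter n tau d.
Proof. by elim: n => //= n ->; rewrite rmorphN. Qed.

Lemma sl2_fracS n : F * sl2_frac n = iD (H + (n + 2)%:R) * sl2_frac n.+1.
Proof.
rewrite /sl2_frac -sl2_denVS rmorphM !mulrA -exprS Fexp_H iter_tauN iter_tau_nat.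
by congr (iD _ * _ * _); rewrite -addnn -addn1 !natrD; ring.
Qed.

(* as variables, these maps are not unfolded to differences of products when rewriting *)
Variables ade adf adh : {linear A -> A}.
Hypotheses (adeE : ade =1 ad_op e) (adfE : adf =1 ad_op f).
Hypothesis adhE : adh =1 ad_op (ad_op e f).

Lemma adf_ade x : adf (ade x) = ade (adf x) - adh x.
Proof.
rewrite adfE !adeE adfE adhE ad_op_ad; congr (_ + _).
have -> : ad_op f e = - ad_op e f by rewrite !ad_opE opprB.
by rewrite ad_opN.
Qed.

Lemma ade_adh x : ade (adh x) = adh (ade x) - 2%:R *: ade x.
Proof. by rewrite !adeE !adhE [in RHS]ad_op_ad he ad_opZl addrK. Qed.

(** The commutation relation of F with E^(n + 1) for the adjoint action of sl2. *)
Lemma adf_iter_ade n x : adf (iter n.+1 ade x) =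
  iter n.+1 ade (adf x)
  - n.+1%:R *: (adh (iter n ade x) - n%:R *: iter n ade x).
Proof.
elim: n => [|n IH]; first by rewrite /= adf_ade scale1r scale0r subr0.
rewrite iterS adf_ade IH (linearB ade) (linearZZ ade) (linearB ade) (linearZZ ade).
rewrite ade_adh; set b := ade (iter n ade x); set y := adh b.
rewrite -[LHS]addrA -opprD; congr (_ - _).
rewrite -(addrA y) -opprD -scalerDl !scalerBr !scalerA addrAC -{2}[y]scale1r -scalerDl.
by congr (_ *: _ - _ *: _); rewrite -[n.+2]addn2 -[n.+1]addn1 !natrD; ring.
Qed.

Lemma iter_ade_mul_eq0 m n a b : iter m ade a = 0 -> iter n ade b = 0 ->
  iter (m + n) ade (a * b) = 0.
Proof.
apply: (@derivation_nilpotent_prod _ *%R ade).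
- exact: mulr0.
- exact: mul0r.
- exact: linear0.
- exact: linearD.
- by move=> x y; rewrite !adeE ad_opM.
Qed.

(** The partial sum of length [L] of S_k(a), which is the full sum once (ad e)^L kills
    [a]. *)
Definition sl2_sum k L a : B :=
  \sum_(n < L) divsign K n *: (iA (iter n ade a) * sl2_frac (k + n)).

Lemma sl2_sum_stable k L L' a : iter L ade a = 0 -> (L <= L')%N ->
  sl2_sum k L' a = sl2_sum k L a.
Proof.
move=> aL leL; rewrite /sl2_sum.
rewrite (big_ord_widen L' (fun n => divsign K n *: (iA (iter n ade a) * sl2_frac (k + n))) leL).
rewrite [RHS]big_mkcond /=; apply: eq_bigr => n _; case: ltnP => // leLn.
by rewrite (iter_zero_le (linear0 ade) leLn aL) rmorph0 mul0r scaler0.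
Qed.

Lemma iAZ c a : iA (c *: a) = c *: iA a.
Proof. exact: linearZ. Qed.

Lemma iAB a b : iA (a - b) = iA a - iA b.
Proof. exact: rmorphB. Qed.

Lemma iAD a b : iA (a + b) = iA a + iA b.
Proof. exact: rmorphD. Qed.

Lemma iAM a b : iA (a * b) = iA a * iA b.
Proof. exact: rmorphM. Qed.

Lemma iDD a b : iD (a + b) = iD a + iD b.
Proof. exact: rmorphD. Qed.

Lemma iDM a b : iD (a * b) = iD a * iD b.
Proof. exact: rmorphM. Qed.

Lemma iD_natl n d : iD (d *+ n) = n%:R *: iD d.
Proof. by rewrite rmorphMn scaler_nat. Qed.

Lemma iD_nat n : iD n%:R = n%:R.
Proof. exact: rmorph_nat. Qed.

Lemma iA_ad_h a : iA (adh a) = iD H * iA a - iA a * iD H.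
Proof. by rewrite adhE ad_opE rmorphB !rmorphM /= iA_ef. Qed.

(** A factor n in the n-th term shifts the summation index and changes the sign.  This is the
    source of all the telescopings below. *)
Lemma divsign_sum_shift L (X : nat -> B) :
  \sum_(n < L.+1) divsign K n *: (n%:R *: X n) = - \sum_(n < L) divsign K n *: X n.+1.
Proof.
rewrite big_ord_recl /= scale0r scaler0 add0r -sumrN; apply: eq_bigr => n _.
by rewrite /bump /= add1n scalerA divsignS scaleNr.
Qed.

(** The terms in (ad e)^n(a) Phi_(k + n + 1) have the three coefficients H + k + n + 2, from
    [sl2_fracS], ad H, and -n, the last two from [adf_iter_ade]; they add up to left multiplication by
    H + k + 2. *)
Lemma sl2_sum_mulf k L a : iter L ade a = 0 ->
  F * sl2_sum k L a =
    sl2_sum k L.+1 (adf a) + iD (H + (k + 2)%:R) * sl2_sum k.+1 L a.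
Proof.
move=> aL; rewrite -(@sl2_sum_stable k L L.+1) //.
pose P n := iD H * iA (iter n ade a) - iA (iter n ade a) * iD H - n%:R *: iA (iter n ade a).
have -> : F * sl2_sum k L.+1 a = sl2_sum k L.+1 (adf a)
   + \sum_(n < L.+1) divsign K n *: (iA (iter n ade a) * (F * sl2_frac (k + n)))
   - \sum_(n < L.+1) divsign K n *: (n%:R *: (P n.-1 * sl2_frac (k + n))).
  rewrite /sl2_sum mulr_sumr -big_split -sumrB /=; apply: eq_bigr => -[n _] _ /=.
  rewrite -scalerAr -scalerDr -scalerBr; congr (_ *: _).
  rewrite !(mulrA _ F) (mulrA F) -(iAM f) (mulr_ad f) -adfE iAD iAM mulrDl [in RHS]addrAC.
  congr (_ + _); case: n => [|n]; first by rewrite scale0r subr0.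
  rewrite adf_iter_ade iAB mulrBl; congr (_ - _).
  rewrite iAZ -scalerAl; congr (_ *: (_ * _)).
  by rewrite /P iAB iAZ iA_ad_h.
rewrite -addrA; congr (_ + _).
rewrite (divsign_sum_shift L (fun n => P n.-1 * sl2_frac (k + n))) opprK.
rewrite big_ord_recr /= aL rmorph0 mul0r scaler0 addr0 -big_split /sl2_sum mulr_sumr.
apply: eq_bigr => -[n _] _ /=.
rewrite -scalerAr -scalerDr addnS -addSn; congr (_ *: _).
rewrite sl2_fracS -addSn !(mulrA _ _ (sl2_frac _)) -mulrDl; congr (_ * _).
have -> : H + (k + n + 2)%:R = H + (k + 2)%:R + n%:R by rewrite !natrD; ring.
rewrite /P !iDD !iD_nat mulrDl !mulrDr !mulr_natr mulr_natl scaler_nat.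
have zmodE (V : zmodType) (p q r s : V) : p + q + r + (s - p - r) = s + q.
  by rewrite addrC -(addrA s) -opprD (addrAC p) addrA subrK.
exact: zmodE.
Qed.

Variable X : set B.
Local Notation J := (left_ideal X).
Hypothesis JE : X (iA e).

Lemma JEfrac d : E * iD d \in J.
Proof.
by have [d' <-] := tau_surj d; rewrite -iA_e left_ideal_mull // left_ideal_gen.
Qed.

Lemma E_Fexp n : E * F ^+ n.+1 = F ^+ n.+1 * E + F ^+ n * iD (n.+1%:R * (H - n%:R)).
Proof.
have EF : E * F = F * E + iD H by rewrite -iA_ef ad_opE iAB !iAM addrC subrK.
elim: n => [|n IH]; first by rewrite expr0 !mul1r expr1 subr0.
rewrite exprSr mulrA IH mulrDl -mulrA EF mulrDr mulrA -exprSr -addrA; congr (_ + _).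
have -> : n.+1%:R * (H - n%:R) = tau (n.+1%:R * (H - n.+2%:R)).
  rewrite rmorphM rmorphB /= tauH !rmorph_nat; congr (_ * _).
  by rewrite -[n.+2]addn2 natrD; ring.
rewrite -mulrA -iA_f mulrA -exprSr -mulrDr -iDD; congr (_ * iD _).
by rewrite -[n.+2]addn2 -[n.+1]addn1 !natrD; ring.
Qed.

Lemma E_frac n : E * sl2_frac n.+1 - n.+1%:R *: sl2_frac n \in J.
Proof.
rewrite /sl2_frac -(sl2_denVS n) mulrA E_Fexp mulrDl -(mulrA _ E) -(mulrA _ (iD _)) -iDM.
rewrite -[n.+1%:R * _ * _]mulrA mulr_natl iD_natl -scalerAr addrK.
by rewrite left_ideal_mull // JEfrac.
Qed.

Lemma E_frac0 : E * sl2_frac 0 \in J.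
Proof. by rewrite sl2_frac0 -(rmorph1 iD) JEfrac. Qed.

(** Modulo [J], E Phi_(n + 1) = (n + 1) Phi_n, so that the two terms of
    E (ad e)^n(a) = (ad e)^(n + 1)(a) + (ad e)^n(a) E cancel in consecutive summands. *)
Lemma sl2_sum_mule L a : iter L ade a = 0 -> E * sl2_sum 0 L a \in J.
Proof.
move=> aL; rewrite -(@sl2_sum_stable 0 L L.+1) //.
have -> : E * sl2_sum 0 L.+1 a =
   \sum_(n < L.+1) divsign K n *: (iA (iter n.+1 ade a) * sl2_frac n)
   + \sum_(n < L.+1) divsign K n *: (n%:R *: (iA (iter n ade a) * sl2_frac n.-1))
   + \sum_(n < L.+1) divsign K n *: (iA (iter n ade a) * (E * sl2_frac n - n%:R *: sl2_frac n.-1)).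
  rewrite /sl2_sum mulr_sumr -!big_split /=; apply: eq_bigr => -[n _] _ /=.
  rewrite -scalerAr -!scalerDr; congr (_ *: _).
  rewrite mulrA -iAM (mulr_ad e) -adeE iAD mulrDl -addrA; congr (_ + _).
  by rewrite mulrBr scalerAr addrC subrK iAM -(mulrA _ E).
rewrite (divsign_sum_shift L (fun n => iA (iter n ade a) * sl2_frac n.-1)).
rewrite big_ord_recr /= -[ade (iter L ade a)]iterS.
rewrite (iter_zero_le (linear0 ade) (leqnSn L) aL) rmorph0 mul0r scaler0 addr0 subrr add0r.
apply: rpred_sum => -[n _] _ /=; rewrite left_idealZ // left_ideal_mull //.
case: n => [|n]; last exact: E_frac.
by rewrite scale0r subr0 E_frac0.
Qed.

Lemma iter_ade_mul n a b : iter n ade (a * b) =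
  \sum_(j < n.+1) 'C(n, j)%:R *: (iter j ade a * iter (n - j) ade b).
Proof.
elim: n => [|n IH]; first by rewrite big_ord1 scale1r.
pose T i j := iter i ade a * iter j ade b.
rewrite iterS IH raddf_sum [RHS]big_ord_recl /= bin0 scale1r.
have adeM x y : ade (x * y) = ade x * y + x * ade y by rewrite !adeE ad_opM.
rewrite [LHS](_ : _ = \sum_(j < n.+1) 'C(n, j)%:R *: T j.+1 (n - j)%N
    + \sum_(j < n.+1) 'C(n, j)%:R *: T j (n.+1 - j)%N); last first.
  rewrite -big_split; apply: eq_bigr => j _ /=.
  by rewrite (linearZZ ade) adeM scalerDr -!iterS -(subSn (leq_ord j)).
rewrite [X in _ + X](_ : _ = T 0%N n.+1
    + \sum_(j < n.+1) 'C(n, j.+1)%:R *: T j.+1 (n - j)%N); last first.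
  transitivity (\sum_(j < n.+2) 'C(n, j)%:R *: T j (n.+1 - j)%N).
    by rewrite [RHS]big_ord_recr /= bin_small // scale0r addr0.
  by rewrite big_ord_recl bin0 scale1r subn0.
rewrite addrCA; congr (_ + _); rewrite -big_split; apply: eq_bigr => j _ /=.
by rewrite -scalerDl -natrD addnC -binS.
Qed.

(** The Leibniz rule for the divided powers of ad e, with the terms arranged by the power
    that falls on [a]. *)
Lemma sl2_sum_mul k L L' a b : iter L ade a = 0 -> iter L' ade b = 0 ->
  sl2_sum k (L + L') (a * b) =
  \sum_(j < L) divsign K j *: (iA (iter j ade a) * sl2_sum (k + j) L' b).
Proof.
move=> aL bL.
pose T j l := divsign K j *: (iA (iter j ade a) *
  (divsign K l *: (iA (iter l ade b) * sl2_frac (k + j + l)))).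
have -> : sl2_sum k (L + L') (a * b) = \sum_(n < L + L') \sum_(j < n.+1) T j (n - j)%N.
  apply: eq_bigr => n _; rewrite iter_ade_mul raddf_sum mulr_suml scaler_sumr /=.
  apply: eq_bigr => j _; rewrite iAZ iAM -scalerAl scalerA /T.
  have le_jn : (j <= n)%N by rewrite -ltnS.
  rewrite -addnA subnKC // -scalerAr scalerA -(mulrA (iA _)); congr (_ *: _).
  by rewrite -divsignM subnKC.
rewrite (sum_triangle T).
have inner j : (j < L)%N ->
    \sum_(l < L + L' - j) T j l = divsign K j *: (iA (iter j ade a) * sl2_sum (k + j) L' b).
  move=> lt_jL; rewrite -(@sl2_sum_stable _ L' (L + L' - j)) //; last by lia.
  by rewrite /sl2_sum mulr_sumr scaler_sumr.
rewrite [RHS](big_ord_widen (L + L') (fun j =>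
  divsign K j *: (iA (iter j ade a) * sl2_sum (k + j) L' b)) (leq_addr _ _)).
rewrite [RHS]big_mkcond /=; apply: eq_bigr => j _; case: ltnP => [/inner //|leLj].
apply: big1 => l _.
by rewrite /T (iter_zero_le (linear0 ade) leLj aL) rmorph0 mul0r scaler0.
Qed.

Lemma ade_e : ade e = 0.
Proof. by rewrite adeE ad_opE subrr. Qed.

Lemma ade2_f : ade (ade f) = - (2%:R *: e).
Proof. by rewrite !adeE -he; move: (ad_op e f) => h; rewrite !ad_opE opprB. Qed.

Lemma ade3_f : iter 3 ade f = 0.
Proof. by rewrite /= ade2_f linearN (linearZZ ade) ade_e scaler0 oppr0. Qed.

(** The series of F has three terms, F Phi_k - H Phi_(k + 1) - E Phi_(k + 2). *)
Lemma sl2_sum_f k : sl2_sum k 3 f \in J.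
Proof.
have c1 : divsign K 1 = -1 by rewrite /divsign expr1 divr1.
have c2 : divsign K 2 = 2%:R^-1 by rewrite /divsign sqrrN expr1n div1r.
rewrite /sl2_sum !big_ord_recr big_ord0 /= add0r ade2_f addn0 addn1 addn2 c1 c2 divsign0.
rewrite rmorphN /= iAZ mulNr scalerN -scalerAl scalerA mulVf ?pnatr_eq0 // !scale1r scaleN1r.
rewrite sl2_fracS adeE iA_ef iDD mulrDl [X in X - E * _]addrAC subrr add0r iD_nat addn2.
by rewrite mulr_natl -scaler_nat -opprB rpredN E_frac.
Qed.

(** * Vanishing on the radical *)
Variable M : set A.
Hypothesis ME : forall z, M z -> M (ade z).
Hypothesis MF : forall z, M z -> M (adf z).
Hypothesis JM : forall z, M z -> X (iA z).
Hypothesis M_normal : forall z d, M z ->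
  (exists d', iA z * iD d = iD d' * iA z) /\ (exists d', iD d * iA z = iA z * iD d').

Lemma radical_iter_ade n z : M z -> M (iter n ade z).
Proof. by move=> Mz; elim: n => //= n; apply: ME. Qed.

(** The radical is moved to the right of the powers of F, being stable under ad f. *)
Lemma radical_mul_Fexp z n d : M z -> iA z * (F ^+ n * iD d) \in J.
Proof.
elim: n z => [|n IH] z Mz.
  have [[d' zd] _] := M_normal d Mz.
  by rewrite expr0 mul1r zd left_ideal_mull // left_ideal_gen //; apply: JM.
rewrite exprS -mulrA mulrA -iAM.
have -> : z * f = f * z - adf z by rewrite adfE ad_opE opprB addrC subrK.
rewrite iAB iAM mulrBl -mulrA rpredB //; first by rewrite left_ideal_mull // IH.
by apply: IH; apply: MF.
Qed.

Lemma radical_mul_frac z n : M z -> iA z * sl2_frac n \in J.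
Proof. exact: radical_mul_Fexp. Qed.

Lemma sl2_sum_radical k L z : M z -> sl2_sum k L z \in J.
Proof.
by move=> Mz; apply: rpred_sum => j _; apply/left_idealZ/radical_mul_frac/radical_iter_ade.
Qed.

Lemma sl2_sum_mulJ k L L' a u : iter L ade a = 0 -> iter L' ade u = 0 ->
  u = f \/ M u -> sl2_sum k (L + L') (a * u) \in J.
Proof.
move=> aL uL fM; rewrite sl2_sum_mul //.
apply: rpred_sum => j _; apply/left_idealZ/left_ideal_mull.
case: fM => [uf|/sl2_sum_radical //].
have u3 : iter 3 ade u = 0 by rewrite uf ade3_f.
rewrite -(sl2_sum_stable _ uL (leq_maxl L' 3)) (sl2_sum_stable _ u3 (leq_maxr L' 3)).
by rewrite uf sl2_sum_f.
Qed.

(** * Extension of the series to the localized algebra *)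

Hypothesis ade_nil : forall a, exists n, iter n ade a = 0.
Hypothesis XD : forall u, X u -> exists s : seq A,
  (forall v, v \in s -> (exists c, v = c *: e) \/ M v) /\ u = iA (\sum_(v <- s) v).
Variable Y : set B.
Local Notation J' := (left_ideal Y).
Hypothesis YD : forall u, Y u -> exists s : seq A,
  (forall v, v \in s -> (exists c, v = c *: f) \/ M v) /\ u = iA (\sum_(v <- s) v).

(** Weight vectors, through the translation of [D] by their weight. *)
Definition homog (a : A) := exists t : D -> D,
  (forall d, iD d * iA a = iA a * iD (t d)) /\ (forall d, t (tau d) = tau (t d)).
Hypothesis B_span : forall x : B, exists s : seq (A * D),
  (forall p, p \in s -> homog p.1) /\ x = \sum_(p <- s) iA p.1 * iD p.2.

Variable r : B -> B.
Hypothesis rD : forall x y, r (x + y) - (r x + r y) \in J.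
Hypothesis r_iA : forall a L, iter L ade a = 0 -> r (iA a) - sl2_sum 0 L a \in J.
Hypothesis r_iD : forall x d, r (x * iD d) - r x * iD (tau d) \in J.

(** The extension of S_k to [B], as a map to representatives modulo [J].  The recursion only
    involves left multiplications and the values of q, so it needs no unique decomposition of the
    elements of [B]; that it extends S_k is [qbar_sl2_sum]. *)
Fixpoint qbar k x : B :=
  if k is k'.+1 then iD (H + (k' + 2)%:R)^-1 * (F * qbar k' x - qbar k' (F * x))
  else r x.

Lemma lideal_mulr_iD x d : x \in J -> x * iD d \in J.
Proof.
move=> Jx; apply: left_ideal_mulr Jx => u /XD [s [sP ->]].
rewrite rmorph_sum mulr_suml big_seq /= rpred_sum // => v /sP [[c ->]|Mv].
  by rewrite iAZ -scalerAl left_idealZ // JEfrac.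
have [[d' ->] _] := M_normal d Mv; rewrite left_ideal_mull // left_ideal_gen //; exact: JM.
Qed.

Lemma qbarD k x y : qbar k (x + y) - (qbar k x + qbar k y) \in J.
Proof.
elim: k x y => [|k IH] x y /=; first exact: rD.
rewrite -mulrDr; apply: lideal_mull.
have -> : F * qbar k x - qbar k (F * x) + (F * qbar k y - qbar k (F * y)) =
   F * (qbar k x + qbar k y) - (qbar k (F * x) + qbar k (F * y)).
  by rewrite mulrDr opprD addrACA.
apply: lideal_sub; first exact: lideal_mull.
by rewrite mulrDr.
Qed.

Lemma qbar0 k : qbar k 0 \in J.
Proof.
by have := lideal_sym (qbarD k 0 0); rewrite addr0 addrK.
Qed.

Lemma qbar_sum k (I : Type) (s : seq I) (x : I -> B) :
  qbar k (\sum_(i <- s) x i) - \sum_(i <- s) qbar k (x i) \in J.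
Proof.
elim: s => [|i s IH]; first by rewrite !big_nil subr0 qbar0.
rewrite !big_cons; apply: lideal_trans (qbarD _ _ _) _.
exact: lideal_add (lideal_refl _) IH.
Qed.

(** As F (a d) = [F, a] d + (a F) d, and the series of a F vanishes modulo [J], the recursion
    defining [qbar] becomes [sl2_sum_mulf]. *)
Lemma qbar_sl2_sum k a d L : iter L ade a = 0 ->
  qbar k (iA a * iD d) - sl2_sum k L a * iD (tau d) \in J.
Proof.
elim: k a d L => [|k IH] a d L aL /=.
  by apply: lideal_trans (r_iD _ _) _; rewrite -mulrBl lideal_mulr_iD // r_iA.
have [L' faL'] := ade_nil (adf a).
pose N := maxn L L'.
have aN : iter N ade a = 0 by apply: iter_zero_le aL; rewrite ?linear0 ?leq_maxl.
have faN : iter N ade (adf a) = 0.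
  by apply: iter_zero_le faL'; rewrite ?linear0 ?leq_maxr.
rewrite -(sl2_sum_stable _ aL (leq_maxl L L')) -/N.
have uH := H_unitD (k + 2).
have -> : sl2_sum k.+1 N a * iD (tau d) = iD (H + (k + 2)%:R)^-1 *
   (F * (sl2_sum k N a * iD (tau d)) - sl2_sum k N.+1 (adf a) * iD (tau d)).
  rewrite (mulrA F) -mulrBl sl2_sum_mulf // addrAC subrr add0r !mulrA -iDM.
  by rewrite mulVr // rmorph1 mul1r.
apply/lideal_mull/lideal_sub; first by apply/lideal_mull/IH.
have -> : F * (iA a * iD d) = iA (adf a) * iD d + iA (a * f) * iD d.
  by rewrite mulrA -iAM -mulrDl -iAD; congr (iA _ * _); rewrite adfE ad_opE subrK.
apply: lideal_trans (qbarD _ _ _) _.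
rewrite -[X in _ - X]addr0; apply: lideal_add.
  rewrite (sl2_sum_stable _ faN (leqnSn N)); exact: IH.
have afN : iter (N + 3) ade (a * f) = 0.
  by apply: iter_ade_mul_eq0 => //; exact: ade3_f.
apply: lideal_trans (IH _ _ _ afN) _; rewrite subr0 lideal_mulr_iD //.
by apply: sl2_sum_mulJ => //; [exact: ade3_f | left].
Qed.

(** A scalar d between a and v can be moved to the right, where it has no effect on the ideal;
    then [sl2_sum_mulJ] applies. *)
Lemma qbar_left_ideal k x : x \in J' -> qbar k x \in J.
Proof.
move=> /asboolP [s [sY ->]].
apply: lideal_congr (qbar_sum _ _ _) _; rewrite big_seq rpred_sum //.
move=> [b u] /sY /= /YD [t [tP ->]].
rewrite rmorph_sum mulr_sumr /=; apply: lideal_congr (qbar_sum _ _ _) _.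
rewrite big_seq rpred_sum // => v /tP vP.
have [w [_ ->]] := B_span b.
rewrite mulr_suml; apply: lideal_congr (qbar_sum _ _ _) _.
rewrite rpred_sum // => -[a d] _ /=.
wlog [c [v' [-> v'P]]] : / exists c v', v = c *: v' /\ (v' = f \/ M v').
  apply; case: vP => [[c ->]|Mv]; first by exists c, f; split=> //; left.
  by exists 1, v; rewrite scale1r; split=> //; right.
have [d' dv] : exists d', iD d * iA v' = iA v' * iD d'.
  case: v'P => [->|/(M_normal d) [_ //]].
  by have [d' <-] := tau_surj d; exists d'; rewrite iA_f.
rewrite iAZ -scalerAr -mulrA dv scalerAl mulrA -iAZ -iAM.
have [L aL] := ade_nil (c *: a).
have [L' vL'] := ade_nil v'.
have avL := iter_ade_mul_eq0 aL vL'.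
apply: lideal_congr (qbar_sl2_sum _ _ avL) _; rewrite lideal_mulr_iD //.
exact: sl2_sum_mulJ.
Qed.

Lemma qbar_mul k a x L : iter L ade a = 0 -> qbar k (iA a * x)
  - \sum_(j < L) divsign K j *: (iA (iter j ade a) * qbar (k + j) x) \in J.
Proof.
move=> aL.
have [s [_ ->]] := B_span x.
rewrite mulr_sumr; apply: lideal_trans (qbar_sum _ _ _) _.
apply: lideal_trans (_ : _ - \sum_(p <- s) \sum_(j < L) divsign K j *:
   (iA (iter j ade a) * qbar (k + j) (iA p.1 * iD p.2)) \in J) _.
  rewrite -sumrB; apply: rpred_sum => -[b d] _ /=.
  have [L' bL] := ade_nil b.
  have abL := iter_ade_mul_eq0 aL bL.
  rewrite mulrA -iAM; apply: lideal_trans (qbar_sl2_sum _ _ abL) _.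
  rewrite sl2_sum_mul // mulr_suml -sumrB; apply: rpred_sum => j _.
  rewrite -scalerAl -scalerBr; apply: left_idealZ; rewrite -mulrA.
  by apply/lideal_mull/lideal_sym/qbar_sl2_sum.
rewrite exchange_big -sumrB; apply: rpred_sum => j _ /=.
rewrite -scaler_sumr -mulr_sumr -scalerBr; apply: left_idealZ.
by apply/lideal_mull/lideal_sym/qbar_sum.
Qed.

Lemma sl2_sum_homog L a t : (forall d, iD d * iA a = iA a * iD (t d)) ->
  (forall d, t (tau d) = tau (t d)) ->
  forall d, iD d * sl2_sum 0 L a = sl2_sum 0 L a * iD (t d).
Proof.
move=> at_ tC d; rewrite /sl2_sum mulr_sumr mulr_suml; apply: eq_bigr => -[n _] _ /=.
rewrite -scalerAr -scalerAl; congr (_ *: _).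
have an d1 : iD d1 * iA (iter n ade a) = iA (iter n ade a) * iD (iter n tau (t d1)).
  elim: n d1 => [|n IH] d1; first exact: at_.
  rewrite iterS adeE ad_opE iAB !iAM mulrBr mulrBl mulrA iA_e -mulrA IH mulrA -mulrA.
  by rewrite (mulrA (iD d1)) IH -(mulrA _ (iD _)) iA_e !mulrA tC -iterSr.
rewrite mulrA an -!mulrA /sl2_frac; congr (_ * _).
by rewrite add0n [LHS]mulrA -Fexp_D -!mulrA -!iDM; congr (_ * iD _); exact: mulrC.
Qed.

(** On a weight vector, d and the terms of the series are exchanged at the price of the same
    translation, before and after applying q. *)
Lemma q_repr_iDl d x : r (iD d * x) - iD (tau d) * r x \in J.
Proof.
have [s [sP ->]] := B_span x.
rewrite mulr_sumr; apply: lideal_trans (qbar_sum 0 _ _) _.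
apply: lideal_trans (lideal_mull _ (lideal_sym (qbar_sum 0 _ _))).
rewrite mulr_sumr -sumrB big_seq rpred_sum // => -[a c] /sP [t [at_ tC]] /=.
have [L aL] := ade_nil a.
rewrite mulrA at_ -mulrA -iDM.
apply: lideal_trans (qbar_sl2_sum 0 _ aL) _.
apply: lideal_trans (lideal_mull _ (lideal_sym (qbar_sl2_sum 0 _ aL))).
by rewrite mulrA (sl2_sum_homog L at_ tC) -mulrA -iDM tC rmorphM subrr rpred0.
Qed.

Lemma e_mul_q_repr x : E * r x \in J.
Proof.
have [s [_ ->]] := B_span x.
apply: lideal_congr (lideal_mull _ (qbar_sum 0 _ _)) _.
rewrite mulr_sumr rpred_sum // => -[a c] _ /=.
have [L aL] := ade_nil a.
apply: lideal_congr (lideal_mull _ (qbar_sl2_sum 0 _ aL)) _.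
by rewrite mulrA lideal_mulr_iD // sl2_sum_mule.
Qed.

Section Normalizer.
Variable y : B.
Hypothesis yN : forall u, u = f \/ M u -> iA u * y \in J'.

(** The term [qbar k (F * y)] of the recursion vanishes since [F * y] is in [J']. *)
Lemma qbar_normalizer k : qbar k y - sl2_frac k * r y \in J.
Proof.
elim: k => [|k IH] /=; first by rewrite sl2_frac0 mul1r lideal_refl.
have -> : sl2_frac k.+1 * r y = iD (H + (k + 2)%:R)^-1 * (F * (sl2_frac k * r y) - 0).
  by rewrite subr0 (mulrA F) sl2_fracS !mulrA -iDM mulVr ?H_unitD // rmorph1 mul1r.
apply/lideal_mull/lideal_sub; first exact: lideal_mull.
by rewrite subr0; apply/qbar_left_ideal/yN; left.
Qed.

(** In the Leibniz formula for z y, whose value is zero, the term j = 0 is z S_k(y) and the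
    other ones involve (ad e)^j(z), of smaller nilpotency order. *)
Lemma radical_mul_qbar z k : M z -> iA z * qbar k y \in J.
Proof.
have [N zN] := ade_nil z; elim: N z k zN => [|N IH] z k zN Mz.
  by move: zN => /= ->; rewrite rmorph0 mul0r rpred0.
have := qbar_mul k y zN; rewrite big_ord_recl /= divsign0 scale1r addn0 => zy.
have zyJ : qbar k (iA z * y) \in J by apply/qbar_left_ideal/yN; right.
set S := \sum_(_ < _) _ in zy.
have -> : iA z * qbar k y = qbar k (iA z * y) - S - (qbar k (iA z * y) - (iA z * qbar k y + S)).
  by rewrite opprB [RHS]addrC addrA subrK addrK.
do 2?[apply: rpredB => //].
apply: rpred_sum => j _; rewrite left_idealZ //= -iterS.
apply: IH; last exact: radical_iter_ade.
by rewrite -iterD; apply: iter_zero_le zN; [exact: linear0|lia].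
Qed.

(** This makes the right action of q(y) on the quotient by [J] well defined. *)
Lemma lideal_mul_q_repr x : x \in J -> x * r y \in J.
Proof.
apply: left_ideal_mulr => u /XD [s [sP ->]].
rewrite rmorph_sum mulr_suml big_seq /= rpred_sum // => v /sP [[c ->]|Mv].
  by rewrite iAZ -scalerAl left_idealZ // e_mul_q_repr.
exact: radical_mul_qbar 0%N Mv.
Qed.

(** Each S_j(y) in the Leibniz formula is Phi_j q(y), and the sum reassembles into q(a). *)
Lemma q_repr_iA_mul a : r (iA a * y) - r (iA a) * r y \in J.
Proof.
have [L aL] := ade_nil a.
apply: lideal_trans (qbar_mul 0 y aL) _.
apply: lideal_trans (_ : _ - sl2_sum 0 L a * r y \in J) _; last first.
  by rewrite -mulrBl lideal_mul_q_repr // lideal_sym // r_iA.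
rewrite mulr_suml -sumrB; apply: rpred_sum => j _.
rewrite -scalerAl -mulrA -scalerBr; apply/left_idealZ/lideal_mull; exact: qbar_normalizer.
Qed.
End Normalizer.

(** For x = a d, the element d y normalizes [J'] as y does, so that q(a d y) = q(a) q(d y). *)
Theorem q_repr_mul x y : (forall u, u = f \/ M u -> iA u * y \in J') ->
  r (x * y) - r x * r y \in J.
Proof.
move=> yN; have [s [_ ->]] := B_span x.
rewrite mulr_suml; apply: lideal_trans (qbar_sum 0 _ _) _.
apply: lideal_trans (_ : _ - (\sum_(p <- s) r (iA p.1 * iD p.2)) * r y \in J) _; last first.
  by rewrite -mulrBl lideal_mul_q_repr // lideal_sym //; apply: (qbar_sum 0).
rewrite mulr_suml -sumrB; apply: rpred_sum => -[a d] _ /=.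
have dyN u : u = f \/ M u -> iA u * (iD d * y) \in J'.
  move=> uP; have [d' ud] : exists d', iA u * iD d = iD d' * iA u.
    by case: uP => [->|/(M_normal d) [] //]; exists (tau d); rewrite iA_f.
  by rewrite mulrA ud -mulrA left_ideal_mull // yN.
rewrite -mulrA; apply: lideal_trans (q_repr_iA_mul dyN a) _.
apply: lideal_trans (lideal_mull _ (q_repr_iDl _ _)) _.
by rewrite mulrA -mulrBl lideal_mul_q_repr // lideal_sym // r_iD.
Qed.

End Operators.

(** * Weights and nilpotency in admissible algebras *)

Lemma descriptionP (T : Type) (x0 : T) (P : set T) : (exists x, P x) -> P (description x0 P).
Proof. by rewrite /description; case: pselect => // exP _; case: cid. Qed.

Section AdmissibleTheory.
Variables (K : numFieldType) (g : kacMoody K) (U : algType K) (iU : {linear g -> U}).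
Variables (A : algType K) (jA : {lrmorphism U -> A}).
Hypotheses (hU : is_uea iU) (hA : admissible iU jA).
Local Notation jU x := (jA (iU x)).
Local Notation hc i := (tnth (km_coroot g) i).

Lemma jU_bracket x y : jU (bracket x y) = ad_op (jU x) (jU y).
Proof. by have [-> _] := hU; rewrite rmorphB !rmorphM. Qed.

(** An admissible algebra is generated by the image of the Lie algebra and by the stable
    subspace, so a property closed under the algebra operations is checked on these. *)
Lemma admissible_ind (P : set A) : P 0 -> (forall c a b, P a -> P b -> P (c *: a + b)) ->
  P 1 -> (forall a b, P a -> P b -> P (a * b)) -> (forall x, P (jU x)) ->
  (forall (V : lmodType K) (nu : {linear V -> A}), injective nu ->
     (forall gam x, real_roots gam -> root_space gam x ->
        forall v, exists n, iter n (ad_op (jU x)) (nu v) = 0) ->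
     (forall v, exists s : seq V, v = \sum_(u <- s) u /\
        forall u, u \in s -> exists mu : weight g, forall h,
          ad_op (jU (incl h)) (nu u) = (mu h : K) *: nu u) ->
     forall v, P (nu v)) ->
  forall a, P a.
Proof.
move=> P0 Plin P1 PM PU PV a.
have [_ [V [nu [nu_inj [_ UV _ nil wts]]]]] := hA.
have [s ->] := tensor_spanP UV a.
elim/big_ind: _ => [//|x y Px Py|[u v] _ /=]; first by rewrite -[x]scale1r; apply: Plin.
apply: (PM _ _ _ (PV _ _ nu_inj nil wts v)).
apply: (uea_ind hU (P := fun u => P (jA u))) => //.
- by rewrite rmorph1.
- by move=> c x y Px Py; rewrite linearP; apply: Plin.
- by move=> x y Px Py; rewrite rmorphM; apply: PM.
Qed.

Lemma iter_jU n x y : iter n (ad_op (jU x)) (jU y) = jU (iter n (bracket x) y).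
Proof. by elim: n => //= n ->; rewrite jU_bracket. Qed.

Lemma admissible_nilpotent gam x : real_roots gam -> root_space gam x ->
  forall a, exists n, iter n (ad_op (jU x)) a = 0.
Proof.
move=> rg xP; have d0 : ad_op (jU x) 0 = 0 by apply: linear0.
have dD a b : ad_op (jU x) (a + b) = ad_op (jU x) a + ad_op (jU x) b by apply: linearD.
apply: admissible_ind => [|c a b [k ak] [l bl]||a b [k ak] [l bl]|y|V nu _ nil _ v].
- by exists 0%N.
- exists (maxn k l); rewrite iter_additive //.
  have -> : iter (maxn k l) (ad_op (jU x)) (c *: a) = c *: iter (maxn k l) (ad_op (jU x)) a.
    exact: (iter_linearZ (ad_op (jU x))).
  rewrite (iter_zero_le d0 (leq_maxl k l) ak) scaler0 add0r.
  exact: (iter_zero_le d0 (leq_maxr k l) bl).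
- by exists 1%N; rewrite /= ad_opE mulr1 mul1r subrr.
- exists (k + l)%N; apply: (derivation_nilpotent_prod (op := *%R)) => //.
  + exact: mulr0.
  + exact: mul0r.
  + exact: ad_opM.
- have [i [w [hw gE]]] := rg; rewrite gE in xP.
  by have [k yk] := real_root_nilpotent hw y xP; exists k; rewrite iter_jU yk linear0 rmorph0.
- exact: nil rg xP v.
Qed.

Definition ad_weight (mu : weight g) (a : A) :=
  forall h, ad_op (jU (incl h)) a = (mu h : K) *: a.

Lemma chevalley_real_root b i : exists2 gam, real_roots gam & root_space gam (chevalley b i : g).
Proof.
exists (root_comb (single i (sign_of b))); last exact: chevalley_root_space.
case: b; rewrite /= root_comb_single.
  by exists i, id; split; [exact: weyl_id|rewrite scale1r].
exists i, (simple_refl i \o id); split; first exact/weyl_step/weyl_id.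
by rewrite /= simple_refl_simple_root rmorphN1 scaleN1r.
Qed.

(** By [sl2_integral] for the sl2 of each simple root, both of whose root vectors act in a
    locally nilpotent way. *)
Lemma ad_weight_integral mu a : a != 0 -> ad_weight mu a -> integral_wt mu.
Proof.
move=> a0 aw i.
have nil b c : exists n, iter n (ad_op (jU (chevalley b i : g))) c = 0.
  by have [gam rg gP] := chevalley_real_root b i; apply: admissible_nilpotent rg gP c.
pose E : {linear A -> A} := ad_op (jU (chevalley true i : g)).
pose F : {linear A -> A} := ad_op (jU (chevalley false i : g)).
pose H : {linear A -> A} := ad_op (jU (incl (hc i) : g)).
have ef : bracket (chevalley true i : g) (chevalley false i) = incl (hc i) by rewrite /= km_ef eqxx.
apply: (@sl2_integral K A E F H) a0 (aw _) (nil true a) (nil false) => v; rewrite /E /F /H /=.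
- by rewrite ad_op_ad -jU_bracket ef.
- rewrite ad_op_ad -jU_bracket km_hf km_pairing cartan_diag scaleNr !linearN /=.
  by rewrite linearZ /= linearZ /= ad_opN ad_opZl.
- rewrite ad_op_ad -jU_bracket km_he km_pairing cartan_diag.
  by rewrite linearZ /= linearZ /= ad_opZl.
Qed.

Lemma ad_weight_root gam x : root_space gam x -> ad_weight gam (jU x).
Proof. by move=> xP h; rewrite -jU_bracket xP linearZ /= linearZ. Qed.

Lemma admissible_weights a : exists s : seq A, a = \sum_(b <- s) b /\
  forall b, b \in s -> exists2 mu, integral_wt mu & ad_weight mu b.
Proof.
move: a; apply: admissible_ind => [|c _ _ [s [-> sP]] [t [-> tP]]||_ _ [s [-> sP]] [t [-> tP]]|x|].
- by exists [::]; rewrite big_nil.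
- exists ([seq c *: b | b <- s] ++ t); rewrite big_cat big_map scaler_sumr; split=> // b.
  rewrite mem_cat => /orP [/mapP [d /sP [mu muP dP] ->]|/tP //].
  by exists mu => // h; rewrite linearZ /= dP !scalerA mulrC.
- exists [:: 1]; rewrite big_seq1; split=> // b; rewrite inE => /eqP ->.
  exists 0; first by move=> i; exists 0; rewrite zero_lfunE.
  by move=> h; rewrite ad_opE mulr1 mul1r subrr zero_lfunE scale0r.
- exists [seq b * d | b <- s, d <- t]; split.
    by rewrite big_allpairs_dep mulr_suml; apply: eq_bigr => b _; rewrite mulr_sumr.
  move=> _ /allpairsP [[b d] /= [/sP [mu muP bP] /tP [nu nuP dP] ->]].
  exists (mu + nu) => [i|h]; first by rewrite add_lfunE; apply: is_integerD.
  by rewrite ad_opM bP dP -scalerAl -scalerAr -scalerDl add_lfunE.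
- have [s [sP ->]] := triangular_decomposition x.
  exists [seq jU p.2 | p <- s]; rewrite big_map !raddf_sum; split=> // _ /mapP [p /sP pP ->].
  exists p.1; last exact/ad_weight_root/basic_root_space.
  case: pP => [[-> _]|[b [j [t [c [-> _]]]]]]; last exact: integral_comb.
  by move=> i; exists 0; rewrite zero_lfunE.
- move=> V nu nu_inj _ wts v; have [s [-> sP]] := wts v.
  exists [seq nu u | u <- s & u != 0]; split.
    rewrite raddf_sum big_map big_filter [LHS](bigID (fun u => u != 0)) /=.
    by rewrite [X in _ + X]big1 ?addr0 // => u /negPn/eqP ->; rewrite linear0.
  move=> _ /mapP [u + ->]; rewrite mem_filter => /andP [u0 /sP [mu uP]].
  exists mu => //; apply: (ad_weight_integral _ uP).
  by apply: contra_neq u0 => e; apply: nu_inj; rewrite e linear0.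
Qed.
End AdmissibleTheory.

(** * Translations of the localized Cartan part *)

Section LocalizedTheory.
Variables (K : numFieldType) (g : kacMoody K) (U : algType K) (iU : {linear g -> U}).
Variables (Uh : comAlgType K) (iUh : {linear cartan_alg g -> Uh}).
Variables (kappa : {lrmorphism Uh -> U}) (D : comUnitAlgType K) (phi : {lrmorphism Uh -> D}).
Variables (A : algType K) (jA : {lrmorphism U -> A}).
Variables (A' : algType K) (iA : {lrmorphism A -> A'}) (iD : {lrmorphism D -> A'}).
Hypotheses (hU : is_uea iU) (hUh : is_uea (iUh : {linear abelian_lie (cartan_alg g) -> Uh})).
Hypothesis hkappa : forall h, kappa (iUh h) = iU (incl h).
Hypothesis hD : is_localization phi (denominators iUh).
Hypothesis hA : admissible iU jA.
Hypothesis hA' : is_localized_algebra kappa phi jA iA iD.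
Local Notation jU x := (jA (iU x)).
Local Notation ph h := (phi (iUh h)).

Lemma denominator_unit gam (k : int) : Defs.roots gam -> ph (h_ gam) + k%:~R \is a GRing.unit.
Proof.
move=> rg; have -> : ph (h_ gam) + k%:~R = phi (iUh (h_ gam) + k%:~R).
  by rewrite rmorphD rmorph_int.
apply: (localization_unit hD); exists [:: iUh (h_ gam) + k%:~R]; rewrite big_seq1.
by split=> // x; rewrite inE => /eqP ->; exists gam, k.
Qed.

(** The translation exists because an integral weight takes integral values on the [h_] of all
    roots, so it permutes the factors of the denominators. *)
Lemma shiftP mu : integral_wt mu -> forall h, shift iUh phi mu (ph h) = ph h + (mu h : K)%:A.
Proof.
move=> muP; rewrite /shift; apply: (@descriptionP _ _ [set t : {lrmorphism D -> D} |
  forall h, t (ph h) = ph h + (mu h : K)%:A]).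
have [psi psiE] := uh_translation hUh phi (linearP mu : linear (mu : cartan_alg g -> K^o)).
have [|s s' [t [tP ->]] [t' [t'P ->]]|s [t [tP ->]]|T TE] := localization_ext hD (psi := psi).
- by exists [::]; rewrite big_nil.
- exists (t ++ t'); rewrite big_cat; split=> // x; rewrite mem_cat => /orP [/tP|/t'P] //.
- rewrite rmorph_prod big_seq rpred_prod // => x /tP [gam [k [rg ->]]].
  have [m mE] := roots_h_integral rg muP.
  rewrite rmorphD rmorph_int /= psiE mE -addrA.
  have -> : (m%:~R : K)%:A + k%:~R = (m + k)%:~R :> D by rewrite scaler_int rmorphD.
  exact: denominator_unit.
by exists T => h; rewrite TE psiE.
Qed.

Lemma iD_h h : iD (ph h) = iA (jU (incl h)).
Proof. by have [<- _] := hA'; rewrite hkappa. Qed.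

Lemma iDA (c : K) : iD c%:A = c%:A.
Proof. by rewrite linearZ /= rmorph1. Qed.

Lemma ad_weight_shiftl mu a : integral_wt mu -> ad_weight iU jA mu a ->
  forall d, iD d * iA a = iA a * iD (shift iUh phi mu d).
Proof.
move=> muP aP d; apply/esym; move: d.
apply: (intertwine hUh hD (f1 := iD \o shift iUh phi mu : {lrmorphism D -> A'}) (f2 := iD)).
move=> h; rewrite /= shiftP // rmorphD /= iD_h.
have := congr1 iA (aP h); rewrite ad_opE rmorphB !rmorphM /= => /eqP.
rewrite subr_eq => /eqP ->; rewrite mulrDr addrC; congr (_ + _).
by rewrite iDA -scalerAr mulr1; apply/esym/linearZ.
Qed.

Lemma ad_weight_shiftr mu a : integral_wt mu -> ad_weight iU jA (- mu) a ->
  forall d, iA a * iD d = iD (shift iUh phi mu d) * iA a.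
Proof.
move=> muP aP.
apply: (intertwine hUh hD (f1 := iD) (f2 := iD \o shift iUh phi mu : {lrmorphism D -> A'})).
move=> h; rewrite /= shiftP // rmorphD /= iD_h.
have := congr1 iA (aP h); rewrite ad_opE rmorphB !rmorphM /= => /eqP.
have -> : iA ((- mu) h *: a) = - ((mu h : K) *: iA a).
  by rewrite opp_lfunE scaleNr rmorphN; congr (- _); apply: linearZ.
rewrite subr_eq mulrDl => /eqP ->.
by rewrite iDA -scalerAl mul1r addrAC addNr add0r.
Qed.

(** Both sides are morphisms that agree on the Cartan subalgebra. *)
Lemma shiftC mu nu : integral_wt mu -> integral_wt nu ->
  forall d, shift iUh phi mu (shift iUh phi nu d) = shift iUh phi nu (shift iUh phi mu d).
Proof.
move=> muP nuP d.
have := intertwine hUh hD (B := D) (x := 1)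
  (f1 := shift iUh phi mu \o shift iUh phi nu : {lrmorphism D -> D})
  (f2 := shift iUh phi nu \o shift iUh phi mu : {lrmorphism D -> D}).
rewrite /= => /(_ _ d); rewrite mul1r mulr1; apply=> h.
rewrite mul1r mulr1 !shiftP // !rmorphD /= !shiftP // !linearZ /= !rmorph1.
by rewrite addrAC.
Qed.

Lemma shiftK mu : integral_wt mu -> integral_wt (- mu) ->
  cancel (shift iUh phi (- mu)) (shift iUh phi mu).
Proof.
move=> muP NmuP d.
have := intertwine hUh hD (B := D) (x := 1)
  (f1 := shift iUh phi mu \o shift iUh phi (- mu) : {lrmorphism D -> D}) (f2 := idfun).
rewrite /= => /(_ _ d); rewrite mul1r mulr1; apply=> h.
rewrite mul1r mulr1 shiftP // rmorphD /= shiftP // linearZ /= rmorph1.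
by rewrite opp_lfunE scaleNr addrK.
Qed.

(** The localized algebra is given as spanned by the products d a; weight vectors a let the
    scalars be moved to the right. *)
Lemma localized_span x : exists s : seq (A * D),
  (forall p, p \in s -> exists2 mu, integral_wt mu & ad_weight iU jA mu p.1) /\
  x = \sum_(p <- s) iA p.1 * iD p.2.
Proof.
have [_ T] := hA'; have [s ->] := tensor_spanP T x.
elim: s => [|[d a] s [t [tP tE]]]; first by exists [::]; rewrite !big_nil.
rewrite big_cons tE /=.
have [u [-> uP]] := admissible_weights hU hA a.
suff [v [vP ->]] : exists v : seq (A * D),
  (forall p, p \in v -> exists2 mu, integral_wt mu & ad_weight iU jA mu p.1) /\
  iD d * iA (\sum_(b <- u) b) = \sum_(p <- v) iA p.1 * iD p.2.
  by exists (v ++ t); rewrite big_cat; split=> // p; rewrite mem_cat => /orP [/vP|/tP].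
elim: u uP => [|b u IH] uP; first by exists [::]; rewrite !big_nil rmorph0 mulr0.
have [v [vP vE]] := IH (fun b bu => uP b (mem_behead (s := _ :: _) bu)).
have [mu muP bP] := uP b (mem_head _ _).
exists ((b, shift iUh phi mu d) :: v); rewrite !big_cons rmorphD mulrDr vE /=.
split; last by rewrite (ad_weight_shiftl muP bP).
by move=> p; rewrite inE => /orP [/eqP ->|/vP //]; exists mu.
Qed.

End LocalizedTheory.

(** * Multiplicativity of q *)

Lemma q_series_sum (K : numFieldType) (g : kacMoody K) (U : algType K) (iU : {linear g -> U})
  (Uh : comAlgType K) (iUh : {linear cartan_alg g -> Uh})
  (D : comUnitAlgType K) (phi : {lrmorphism Uh -> D})
  (A : algType K) (jA : {lrmorphism U -> A})
  (A' : algType K) (iA : {lrmorphism A -> A'}) (iD : {lrmorphism D -> A'})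
  (alpha : weight g) (e f : g) (a : A) L :
  iter L (ad_op (jA (iU e))) a = 0 ->
  q_series iU iUh phi jA iA iD alpha e f a =
  sl2_sum iA iD (jA (iU f)) (phi (iUh (h_ alpha))) (ad_op (jA (iU e))) 0 L a.
Proof.
move=> aL; rewrite /q_series -(fsbig_widen [set n : nat | (n < L)%N] setT) //; last first.
  move=> n [_ /= /negP]; rewrite -leqNgt => leLn.
  by rewrite /= (iter_zero_le (linear0 (ad_op _)) leLn aL) rmorph0 !mul0r scaler0.
by rewrite -fsbig_ord; apply: eq_bigr => n _; rewrite /sl2_frac mulrA.
Qed.

(** The hypotheses of [q_repr_mul] are verified for the representatives of q chosen by [lrepr]. *)
Theorem q_map_mul (K : numFieldType) (g : kacMoody K)
  (U : algType K) (iU : {linear g -> U})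
  (Uh : comAlgType K) (iUh : {linear cartan_alg g -> Uh})
  (kappa : {lrmorphism Uh -> U})
  (D : comUnitAlgType K) (phi : {lrmorphism Uh -> D})
  (A : algType K) (jA : {lrmorphism U -> A})
  (A' : algType K) (iA : {lrmorphism A -> A'}) (iD : {lrmorphism D -> A'})
  (hU : is_uea iU)
  (hUh : is_uea (iUh : {linear abelian_lie (cartan_alg g) -> Uh}))
  (hkappa : forall h, kappa (iUh h) = iU (incl h))
  (hD : is_localization phi (denominators iUh))
  (hA : admissible iU jA)
  (hA' : is_localized_algebra kappa phi jA iA iD)
  (w : weight g -> weight g) (hw : in_weyl w) (i : 'I_(km_size g))
  (e f : g) (he : root_space (w (tnth (km_root g) i)) e)
  (hf : root_space (- w (tnth (km_root g) i)) f)
  (hef : bracket e f = incl (h_ (w (tnth (km_root g) i)))) :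
  let alpha := w (tnth (km_root g) i) in
  let m : set A' := in_A' iU jA iA @` nil_subalg w in
  let ms : set A' := in_A' iU jA iA @` nil_subalg (refl alpha \o w) in
  let q : A' -> lquot m := q_map iU iUh phi jA iA iD m alpha e f in
  forall x y : A', normalizer ms y ->
    q (x * y) = lquot_act (q x) (q y).
Proof.
move=> alpha m ms q x y yN.
case: (pselect (exists q0 : A' -> lquot m, is_q iU iUh phi jA iA iD alpha e f q0))
  => [exq|nexq]; last first.
  (* when its defining property has no solution, q is zero, and 0 is represented by
     an element of the ideal *)
  have q0 z : q z = 0 by rewrite /q /q_map /description; case: pselect.
  rewrite !q0 /lquot_act /lquot_mulr.
  have l0 : lclass m 0 = 0 by rewrite /lclass piE.
  rewrite -[LHS]l0; apply/esym/lclass_eq; rewrite subr0 left_ideal_mull //.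
  rewrite -[X in X \in _]subr0; apply/lclass_eq; rewrite l0; exact: lreprK.
have [qD q_iA q_iD] : is_q iU iUh phi jA iA iD alpha e f q := descriptionP _ exq.
have [n alpha_comb] := weyl_comb hw (single i 1); rewrite root_comb_single scale1r -/alpha in alpha_comb.
have alphaI : integral_wt alpha by rewrite alpha_comb; apply: integral_comb.
have NalphaI : integral_wt (- alpha) by rewrite alpha_comb -root_combN; apply: integral_comb.
pose M : set A := [set z | exists2 x, radical w i x & z = jA (iU x)].
have Mwt z : M z -> exists mu, [/\ integral_wt mu, integral_wt (- mu) & ad_weight iU jA mu z].
  move=> [x' /(radical_weight) [n' xP] ->]; have [n'' nE] := weyl_comb hw n'.
  exists (w (root_comb n')); rewrite nE -root_combN; split; [exact: integral_comb|exact: integral_comb|].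
  by apply: ad_weight_root => //; rewrite -nE.
have alpha_d : alpha = w (root_comb (single i 1)) by rewrite root_comb_single scale1r.
have Nalpha_d : - alpha = w (root_comb (single i (-1))) by rewrite root_comb_single rmorphN1 scaleN1r weylN.
have root_al : real_roots alpha by exists i, w.
have jU_gens v u : (exists c, u = c *: v) \/ radical w i u ->
   (exists c, jA (iU u) = c *: jA (iU v)) \/ M (jA (iU u)).
  case=> [[c ->]|ru]; last by right; exists u.
  by left; exists c; rewrite linearZ /= linearZ.
pose H := phi (iUh (h_ alpha)).
have alphaH := alpha_coroot i hw.
have ra := roots_alpha hw he hef.
have wt_e : ad_weight iU jA alpha (jA (iU e)) by apply: ad_weight_root.
have wt_f : ad_weight iU jA (- alpha) (jA (iU f)) by apply: ad_weight_root.
have shl mu a := @ad_weight_shiftl _ _ _ iU _ _ _ _ _ _ jA _ _ _ hUh hkappa hD hA' mu a.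
have shr mu a := @ad_weight_shiftr _ _ _ iU _ _ _ _ _ _ jA _ _ _ hUh hkappa hD hA' mu a.
pose ade : {linear A -> A} := ad_op (jA (iU e)).
pose adf : {linear A -> A} := ad_op (jA (iU f)).
pose adh : {linear A -> A} := ad_op (ad_op (jA (iU e)) (jA (iU f))).
rewrite -[LHS]lreprK; apply/lclass_eq.
apply: (@q_repr_mul K A A' D iA iD (jA (iU e)) (jA (iU f)) H (shift iUh phi alpha)
  _ _ _ _ _ _ _ ade adf adh _ _ _ m _ M _ _ _ _ _ _ ms _ _ (fun z => lrepr (q z))).
- by rewrite -jU_bracket // hef /H (iD_h hkappa hA').
- by rewrite -!jU_bracket // hef he -/alpha alphaH linearZ /= linearZ.
- exact: shr.
- exact: shl.
- by move=> d; exists (shift iUh phi (- alpha) d); rewrite (shiftK hUh hD).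
- by rewrite /H (shiftP hUh hD) // -/alpha alphaH scaler_nat.
- by move=> k; apply: denominator_unit.
- by [].
- by [].
- by [].
- exists e => //; exact: e_nil_subalg hef.
- move=> _ [x' rx ->]; exists (bracket e x'); last by rewrite jU_bracket.
  by apply: (radical_bracket hw (m := 1)) rx; rewrite -alpha_d.
- move=> _ [x' rx ->]; exists (bracket f x'); last by rewrite jU_bracket.
  by apply: (radical_bracket hw (m := -1)) rx; rewrite -Nalpha_d.
- by move=> _ [x' rx ->]; exists x' => //; apply: radical_nil_subalg rx.
- move=> z d /Mwt [mu [muP NmuP zP]]; split; last first.
    by exists (shift iUh phi mu d); apply: shl.
  by exists (shift iUh phi (- mu) d); apply: shr => //; rewrite opprK.
- exact: (admissible_nilpotent hU hA root_al he).
- move=> _ [v /(nil_subalgP hw he hef) [s [sP ->]] <-].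
  exists [seq jA (iU u) | u <- s]; split; last by rewrite /in_A' big_map !raddf_sum.
  by move=> _ /mapP [u /sP /jU_gens + ->].
- move=> _ [v /(nil_subalg_reflP hw hf hef) [s [sP ->]] <-].
  exists [seq jA (iU u) | u <- s]; split; last by rewrite /in_A' big_map !raddf_sum.
  by move=> _ /mapP [u /sP /jU_gens + ->].
- move=> z; have [s [sP ->]] := localized_span hU hUh hkappa hD hA hA' z.
  exists s; split=> // p /sP [mu muP pP]; exists (shift iUh phi mu); split; first exact: shl.
  by move=> d; rewrite shiftC.
- by move=> u v; apply/lclass_eq; rewrite lclassD !lreprK.
- move=> a L aL; apply/lclass_eq; rewrite lreprK q_iA; congr lclass.
  exact: q_series_sum.
- by move=> u d; apply/lclass_eq; rewrite lreprK q_iD.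
move=> u [->|[x' rx ->]]; apply: yN.
  exists f => //; exact: f_nil_subalg hef.
by exists x' => //; apply: radical_nil_subalg_refl.
Qed.

Theorem theorem4 (R : realType) (g : kacMoody R[i])
  (U : algType R[i]) (iU : {linear g -> U})
  (Uh : comAlgType R[i]) (iUh : {linear cartan_alg g -> Uh})
  (kappa : {lrmorphism Uh -> U})
  (D : comUnitAlgType R[i]) (phi : {lrmorphism Uh -> D})
  (A : algType R[i]) (jA : {lrmorphism U -> A})
  (A' : algType R[i]) (iA : {lrmorphism A -> A'}) (iD : {lrmorphism D -> A'})
  (hgrowth : finite_growth g)
  (hU : is_uea iU)
  (hUh : is_uea (iUh : {linear abelian_lie (cartan_alg g) -> Uh}))
  (hkappa : forall h, kappa (iUh h) = iU (incl h))
  (hD : is_localization phi (denominators iUh))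
  (hA : admissible iU jA)
  (hA' : is_localized_algebra kappa phi jA iA iD)
  (alpha : weight g) (halpha : real_roots alpha)
  (e f : g) (he : root_space alpha e) (hf : root_space (- alpha) f)
  (hef : bracket e f = incl (h_ alpha))
  (w : weight g -> weight g) (hw : in_weyl w)
  (hsimple : exists i, alpha = w (tnth (km_root g) i)) :
  let m : set A' := in_A' iU jA iA @` nil_subalg w in
  let ms : set A' := in_A' iU jA iA @` nil_subalg (refl alpha \o w) in
  let q : A' -> lquot m := q_map iU iUh phi jA iA iD m alpha e f in
  forall x y : A', normalizer ms y ->
    q (x * y) = lquot_act (q x) (q y).
Proof.
have [i alphaE] := hsimple; rewrite alphaE in he hf hef *.
exact: (@q_map_mul R[i] g U iU Uh iUh kappa D phi A jA A' iA iD hU hUh hkappa hD hA hA'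
  w hw i e f he hf hef).
Qed.
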